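(* Let $F$ be a Banach space. The following statements are equivalent. (a) $F$ has the Schur property. (b) $\mathcal{K}(E,F)=\mathcal{L}(E,F)$ for every reflexive Banach space $E$. (c) $\operatorname{NA}(E,F)=\mathcal{L}(E,F)$ for every reflexive Banach space $E$. (d) $\mathcal{K}(G,F)=\mathcal{L}(G,F)$ for every reflexive Banach space $G$ with a (Schauder) basis. (e) $\operatorname{NA}(G,F)=\mathcal{L}(G,F)$ for every reflexive Banach space $G$ with a (Schauder) basis.
   Context: All Banach spaces are over a fixed field $\mathbb{K}$, which is either $\mathbb{R}$ or $\mathbb{C}$. $\mathcal{L}(E,F)$ is the space of all bounded linear operators from $E$ into $F$, and $\mathcal{K}(E,F)$ is the space of all compact operators from $E$ into $F$. $\operatorname{NA}(E,F)$ is the set of norm-attaining operators, i.e. those $T\in\mathcal{L}(E,F)$ for which there exists $x$ in the closed unit ball of $E$ with $\|T(x)\|=\|T\|$. A Banach space has the Schur property if every weakly convergent sequence in it is norm convergent. *)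

(* Defs.v *)
From HB Require Import structures.
From mathcomp Require Import all_boot all_order all_algebra.
From mathcomp Require Import complex.
From mathcomp Require Import all_classical all_reals all_analysis.

Set Implicit Arguments.
Unset Strict Implicit.
Unset Printing Implicit Defensive.

Import Order.TTheory GRing.Theory Num.Theory.
Import numFieldNormedType.Exports.

Local Open Scope classical_set_scope.
Local Open Scope ring_scope.

(* A Banach space over K is a [completeNormedModType K].  The definitions make
   sense over any [numFieldType]; they are meant for K = R and K = R[i] with
   R : realType.  Norms take values in K itself, and over R[i] the partial order
   of K only compares numbers with a real difference, so that suprema of sets of
   norms are the usual real ones. *)

Definition unit_ball (K : numFieldType) (E : normedModType K) : set E :=
  [set x | `|x| <= 1].
Arguments unit_ball {K} E.

Definition bounded_op (K : numFieldType) (E F : normedModType K) :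
    set (E -> F) :=
  [set T | linear T /\ exists M : K, forall x, `|T x| <= M * `|x|].
Arguments bounded_op {K} E F.

Definition opnorm (K : numFieldType) (E F : normedModType K) (T : E -> F) : K :=
  supremum 0 [set `|T x| | x in unit_ball E].

Definition compact_op (K : numFieldType) (E F : normedModType K) :
    set (E -> F) :=
  [set T | bounded_op E F T /\ precompact (T @` unit_ball E)].
Arguments compact_op {K} E F.

Definition norm_attaining (K : numFieldType) (E F : normedModType K) :
    set (E -> F) :=
  [set T | bounded_op E F T /\
           exists2 x, unit_ball E x & `|T x| = opnorm T].
Arguments norm_attaining {K} E F.

Definition dual (K : numFieldType) (E : normedModType K) : set (E -> K) :=
  bounded_op E K.
Arguments dual {K} E.

(* Elements of the bidual are represented by total functions on [E -> K], of
   which only the restriction to [dual E] is relevant. *)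
Definition bidual (K : numFieldType) (E : normedModType K) :
    set ((E -> K) -> K) :=
  [set Phi |
    (forall (a : K) (f g : E -> K), dual E f -> dual E g ->
       Phi (a *: f + g) = a * Phi f + Phi g) /\
    exists M : K, forall f, dual E f -> `|Phi f| <= M * opnorm f].
Arguments bidual {K} E.

Definition canonical_embedding (K : numFieldType) (E : normedModType K)
    (x : E) : (E -> K) -> K :=
  fun f => f x.

Definition reflexive_space (K : numFieldType) (E : normedModType K) : Prop :=
  forall Phi, bidual E Phi ->
    exists x, forall f, dual E f -> Phi f = canonical_embedding x f.
Arguments reflexive_space {K} E.

Definition weakly_cvg_to (K : numFieldType) (E : normedModType K)
    (u : nat -> E) (x : E) : Prop :=
  forall f, dual E f -> (fun n => f (u n)) @ \oo --> f x.

Definition schur_property (K : numFieldType) (E : normedModType K) : Prop :=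
  forall u : nat -> E, (exists x, weakly_cvg_to u x) -> cvgn u.
Arguments schur_property {K} E.

(* Being indexed by nat, a Schauder basis exists only in an
   infinite-dimensional space. *)
Definition schauder_basis (K : numFieldType) (E : normedModType K)
    (e : nat -> E) : Prop :=
  forall x : E, exists! a : nat -> K, series (fun n => a n *: e n) @ \oo --> x.

Definition has_schauder_basis (K : numFieldType) (E : normedModType K) : Prop :=
  exists e : nat -> E, schauder_basis e.
Arguments has_schauder_basis {K} E.

(* Main.v *)
(** A bounded operator on a reflexive space maps bounded sequences to sequences
    with weakly convergent subsequences, so it is compact when the target has
    the Schur property; and a compact operator on a reflexive space attains its
    norm at a weak limit of a maximizing sequence.

    Conversely, if [F] is not Schur it contains a weakly null sequence [x] of
    unit vectors.  A Davis-Figiel-Johnson-Pelczynski interpolation between the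
    l1-norm and the norm [a |-> sup_l |sum_(i < l) a i x i|] gives a sequence
    space [G] through which [a |-> sum a i x i] factors.  Its unit vectors form
    a basis that is boundedly complete and, because [x] is weakly null,
    shrinking, so [G] is reflexive by James' argument.  Its norm is then
    replaced by an equivalent one, at least
    [|sum a i x i| + sum 2^-i |a i|], for which the operator has norm one but
    does not attain it. *)

Require Import Defs.
From HB Require Import structures.
From mathcomp Require Import all_boot all_order all_algebra.
From mathcomp Require Import complex.
From mathcomp Require Import all_classical all_reals all_analysis.
From mathcomp Require Import ring lra.

Set Implicit Arguments.
Unset Strict Implicit.
Unset Printing Implicit Defensive.

Import Order.TTheory GRing.Theory Num.Theory.
Import numFieldNormedType.Exports.

Local Open Scope classical_set_scope.
Local Open Scope ring_scope.

(** * Scalars *)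

(** The map from l1 sending the unit vectors to [x] is bounded, but l1 is not reflexive;
    interpolation keeps just enough of l1. Its central property is [mix_split]: at each scale [n], a
    vector of bounded norm is the sum of one of l1-norm of order [2 ^ n] and one whose partial sums
    in [F] are of order [2 ^ - n]. On the first piece, information on single [x i] extends to the
    whole sum; the second is negligible. This governs both the convergence of the partial sums and
    the shrinking property. Square summation over the scales makes high scales negligible and lets
    averages of vectors living on different scales become small. In the final norm the interpolation
    part is halved, so that it is at most 1 on unit vectors and the damped partial sums decide: unit
    vector [i] has norm at most [1 + 2 ^ - i], while the operator loses a definite amount on every
    nonzero vector. Weak limits are limits of scalars along ultrafilters, which directly produce
    elements of the bidual. *)

(** [K] stands for either [R] or [R[i]]; [rl] is the identity or the real part.
    It allows all norms to be handled as elements of [R]. *)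
Record real_part (R : realType) (K : numFieldType) := RealPart {
  ofR : {rmorphism R -> K};
  rl : K -> R;
  ofR_le : forall a b, (ofR a <= ofR b) = (a <= b);
  rlD : forall x y, rl (x + y) = rl x + rl y;
  rlM : forall a z, rl (ofR a * z) = a * rl z;
  rl1 : rl 1 = 1;
  ofR_rl_norm : forall z : K, ofR (rl `|z|) = `|z|;
  rl_le_norm : forall z : K, rl z <= rl `|z|;
  rl_extension : forall (E : lmodType K) (g : E -> R),
    (forall x y, g (x + y) = g x + g y) ->
    (forall a x, g (ofR a *: x) = a * g x) ->
    exists f : E -> K, linear f /\ forall x, rl (f x) = g x;
  dense_scalars : exists q : nat -> K,
    forall (z : K) (e : R), 0 < e -> exists n, rl `|z - q n| < e;
  ultra_scalars : forall (T : Type) (U : set_system T) (h : T -> K) (M : R),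
    UltraFilter U -> (\forall t \near U, rl `|h t| <= M) ->
    exists l, forall e : R, 0 < e -> \forall t \near U, rl `|h t - l| < e }.

(** The image of [U] has a cluster point in a compact segment. For an ultrafilter a cluster point is
    a limit, since otherwise the complement of some ball would belong to the image. *)
Lemma ultra_real (R : realType) (T : Type) (U : set_system T) (h : T -> R)
    (M : R) : UltraFilter U -> (\forall t \near U, `|h t| <= M) ->
  exists l, forall e : R, 0 < e -> \forall t \near U, `|h t - l| < e.
Proof.
move=> UU hM.
have hc : (h @ U) `[(- M), M]%classic.
  by apply: filterS hM => t; rewrite ler_norml /= in_itv.
have [l [_ lc]] := @segment_compact R (- M) M (h @ U) _ hc.
exists (l : R) => e e0.
have [hn|hn] := in_ultra_setVsetC (fun t => `|h t - (l : R)| < e) UU.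
  exact: hn.
have hb : (h @ U) [set y : R | e <= `|y - (l : R)|].
  by apply: filterS hn => t /= ht; rewrite leNgt; apply/negP; exact: ht.
have [y [/= hy ly]] := lc _ _ hb (nbhsx_ballx (l : R^o) e e0).
by move: ly; rewrite /ball /= distrC => /lt_le_trans/(_ hy); rewrite ltxx.
Qed.

Lemma dense_real (R : realType) : exists q : nat -> R,
  forall z (e : R), 0 < e -> exists n, `|z - q n| < e.
Proof.
exists (fun n => if unpickle n is Some r then ratr (r : rat) else 0) => z e e0.
have [r] := @rat_in_itvoo R (z - e) (z + e) ltac:(lra).
rewrite in_itv /= => /andP[h1 h2]; exists (pickle r); rewrite pickleK.
by rewrite ltr_norml; apply/andP; split; lra.
Qed.

Lemma real_part_real (R : realType) : inhabited (real_part R R).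
Proof.
apply: inhabits.
refine (@RealPart R R (idfun : {rmorphism R -> R}) id _ _ _ _ _ _ _ _ _) => //=.
- by move=> z; exact: ler_norm.
- move=> E g gD gZ; exists g; split=> // a x y.
  by rewrite gD gZ.
- exact: dense_real.
- exact: ultra_real.
Qed.

Section ComplexScalars.
Variable R : realType.
Local Notation C := R[i].
Local Open Scope complex_scope.
Local Notation Re := (@complex.Re R).
Local Notation Im := (@complex.Im R).

Lemma Re_norm_le (z : C) (e : R) :
  `|Re z| < e -> `|Im z| < e -> Re `|z| < 2 * e.
Proof.
move=> h1 h2; rewrite (complexE z); apply: le_lt_trans (_ : `|Re z| + `|Im z| < _); last by lra.
rewrite -lecR [_%:C]RRe_real ?normr_real// rmorphD /=.
apply: le_trans (ler_normD _ _) _; rewrite normrM.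
by rewrite !normc_def /= !expr0n /= !addr0 add0r expr1n sqrtr1 mul1r !sqrtr_sqr.
Qed.

Lemma real_part_complex : inhabited (real_part R C).
Proof.
apply: inhabits.
refine (@RealPart R C (real_complex R : {rmorphism R -> C}) Re _ _ _ _ _ _ _ _ _).
- by move=> a b; rewrite lecR.
- by case=> [a b] [c d].
- by move=> a [b c] /=; rewrite mul0r subr0.
- by [].
- by move=> z; exact: RRe_real (normr_real z).
- move=> z; apply: le_trans (ler_norm _) _.
  by rewrite -lecR RRe_real ?normr_real// normc_ge_Re.
(* A complex functional is determined by its real part [g]: its imaginary part at [x] has to be
   [- g ('i *: x)]. *)
- move=> E g gD gZ; exists (fun x => g x -i* g ('i *: x)); split=> //.
  have gN x : g (- x) = - g x by have := gZ (-1) x; rewrite rmorphN1 scaleN1r mulN1r.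
  move=> [a b] x y; rewrite /= !scalerDr !gD.
  have e z : (a +i* b) *: z = a%:C *: z + b%:C *: ('i *: z).
    by rewrite scalerA -scalerDl; congr (_ *: _); rewrite [LHS]complexE mulrC [in RHS]mulrC /= mulrC.
  have ei z : 'i *: ('i *: z) = - z :> E.
    by rewrite scalerA -expr2 sqr_i scaleN1r.
  have ii (r : R) (z : E) : 'i *: (r%:C *: z) = r%:C *: ('i *: z).
    by rewrite !scalerA mulrC.
  rewrite !e !scalerDr !ii !ei !gD !gZ !gN.
  by apply/eqP; rewrite eq_complex /=; apply/andP; split; apply/eqP; ring.
- have [q qd] := @dense_real R.
  exists (fun n => if unpickle n is Some p then q (p : nat * nat).1 +i* q p.2 else 0).
  move=> z e e0; have [n hn] := qd (Re z) (e / 2) ltac:(lra).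
  have [m hm] := qd (Im z) (e / 2) ltac:(lra).
  exists (pickle (n, m)); rewrite pickleK /=.
  rewrite (_ : e = 2 * (e / 2)); last by field.
  by apply: Re_norm_le; move: z hn hm => [a b].
- move=> T U h M UU hM.
  have nr (z : C) : `|Re z| <= Re `|z| /\ `|Im z| <= Re `|z|.
    rewrite -!lecR RRe_real ?normr_real//; split; first exact: normc_ge_Re.
    rewrite normc_def lecR -sqrtr_sqr ler_wsqrtr //.
    by rewrite lerDr sqr_ge0.
  have [l1 h1] := @ultra_real R T U (fun t => Re (h t)) M UU
     ltac:(by apply: filterS hM => t; apply: le_trans; have [] := nr (h t)).
  have [l2 h2] := @ultra_real R T U (fun t => Im (h t)) M UU
     ltac:(by apply: filterS hM => t; apply: le_trans; have [] := nr (h t)).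
  exists (l1 +i* l2) => e e0.
  have := h1 (e / 2) ltac:(lra); have := h2 (e / 2) ltac:(lra).
  apply: filterS2 => t a b; rewrite (_ : e = 2 * (e / 2)); last by field.
  by apply: Re_norm_le; move: (h t) a b => [a b].
Qed.

End ComplexScalars.

(** * Norms with values in [R] *)

Section RealNorm.
Context {R : realType} {K : numFieldType} (sc : real_part R K).
Local Notation ofR := (ofR sc).
Local Notation rl := (rl sc).

Definition rnorm (E : semiNormedZmodType K) (x : E) : R := rl `|x|.

Lemma rl_ofR a : rl (ofR a) = a.
Proof. by rewrite -[ofR a]mulr1 rlM rl1 mulr1. Qed.

Lemma rl0 : rl 0 = 0.
Proof. by rewrite -(rmorph0 ofR) rl_ofR. Qed.

Lemma rlN x : rl (- x) = - rl x.
Proof. by apply/eqP; rewrite -addr_eq0 addrC -rlD subrr rl0. Qed.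

Lemma rlB x y : rl (x - y) = rl x - rl y.
Proof. by rewrite rlD rlN. Qed.

Lemma ofR_rl z : 0 <= z -> ofR (rl z) = z.
Proof. by move=> z0; rewrite -[z in LHS]ger0_norm // ofR_rl_norm ger0_norm. Qed.

Lemma ofR_lt a b : (ofR a < ofR b) = (a < b).
Proof. by rewrite !lt_def ofR_le; congr (~~ _ && _); rewrite fmorph_eq. Qed.

Lemma ofR_ge0 a : (0 <= ofR a) = (0 <= a).
Proof. by rewrite -(rmorph0 ofR) ofR_le. Qed.

Lemma ofR_gt0 a : (0 < ofR a) = (0 < a).
Proof. by rewrite -(rmorph0 ofR) ofR_lt. Qed.

Lemma rl_ge0 z : 0 <= z -> 0 <= rl z.
Proof. by move=> z0; rewrite -ofR_ge0 ofR_rl. Qed.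

Lemma rl_mono x y : x <= y -> rl x <= rl y.
Proof. by rewrite -subr_ge0 => /rl_ge0; rewrite rlB subr_ge0. Qed.

Lemma rl_gt0 z : 0 < z -> 0 < rl z.
Proof. by move=> z0; rewrite -ofR_gt0 ofR_rl // ltW. Qed.

Lemma ofR_rnorm (E : semiNormedZmodType K) (x : E) : ofR (rnorm x) = `|x|.
Proof. by rewrite ofR_rl. Qed.

Lemma rnorm_ge0 (E : semiNormedZmodType K) (x : E) : 0 <= rnorm x.
Proof. exact: rl_ge0. Qed.

Lemma rnorm_ofR a : rnorm (ofR a) = `|a|.
Proof.
rewrite /rnorm; have [a0|a0] := leP 0 a.
  by rewrite ger0_norm ?ofR_ge0 // rl_ofR ger0_norm.
rewrite ler0_norm ?rlN ?rl_ofR ?ltr0_norm //.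
by rewrite -oppr_ge0 -rmorphN ofR_ge0; lra.
Qed.

Lemma rnormD (E : semiNormedZmodType K) (x y : E) :
  rnorm (x + y) <= rnorm x + rnorm y.
Proof. by rewrite /rnorm -rlD; exact/rl_mono/ler_normD. Qed.

Lemma rnormN (E : semiNormedZmodType K) (x : E) : rnorm (- x) = rnorm x.
Proof. by rewrite /rnorm normrN. Qed.

Lemma rnormBC (E : semiNormedZmodType K) (x y : E) : rnorm (x - y) = rnorm (y - x).
Proof. by rewrite -rnormN opprB. Qed.

Lemma rnormB (E : semiNormedZmodType K) (x y : E) :
  rnorm (x - y) <= rnorm x + rnorm y.
Proof. by rewrite -[rnorm y]rnormN; exact: rnormD. Qed.

Lemma rnorm_triangle (E : semiNormedZmodType K) (x y z : E) :
  rnorm (x - z) <= rnorm (x - y) + rnorm (y - z).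
Proof. by apply: le_trans (rnormD _ _); rewrite addrA subrK. Qed.

Lemma rnorm0 (E : normedZmodType K) : rnorm (0 : E) = 0.
Proof. by rewrite /rnorm normr0 rl0. Qed.

Lemma rnorm_eq0 (E : normedZmodType K) (x : E) : rnorm x = 0 -> x = 0.
Proof.
move=> x0; apply/eqP; rewrite -normr_eq0; apply/eqP.
by rewrite -ofR_rnorm x0 rmorph0.
Qed.

Lemma rnormM (x y : K) : rnorm (x * y) = rnorm x * rnorm y.
Proof. by rewrite /rnorm normrM -[`|x|]ofR_rnorm rlM rl_ofR. Qed.

Lemma rnorm1 : rnorm (1 : K) = 1.
Proof. by rewrite /rnorm normr1 rl1. Qed.

Lemma rnormZ (E : normedModType K) (a : K) (x : E) :
  rnorm (a *: x) = rnorm a * rnorm x.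
Proof. by rewrite /rnorm normrZ -[`|a|]ofR_rnorm rlM rl_ofR. Qed.

Lemma rnorm_sum (E : normedZmodType K) (I : Type) (r : seq I) (P : pred I)
    (F : I -> E) :
  rnorm (\sum_(i <- r | P i) F i) <= \sum_(i <- r | P i) rnorm (F i).
Proof.
apply: (big_ind2 (fun x y => rnorm x <= y)) => //; first by rewrite rnorm0.
by move=> x1 y1 x2 y2 h1 h2; apply: le_trans (rnormD _ _) (lerD _ _).
Qed.

Lemma rl_le_rnorm (z : K) : rl z <= rnorm z.
Proof. exact: rl_le_norm. Qed.

Lemma rotation (z : K) : exists t : K, rnorm t = 1 /\ t * z = `|z|.
Proof.
have [->|z0] := eqVneq z 0.
  by exists 1; rewrite rnorm1 mulr0 normr0.
exists (`|z| / z); rewrite divfK //; split=> //.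
by rewrite /rnorm normrM normfV normr_id divff ?normr_eq0 // rl1.
Qed.

Lemma cvg_rnorm (E : normedModType K) (T : Type) (F : set_system T)
    (FF : Filter F) (h : T -> E) (l : E) :
  h @ F --> l <-> forall e : R, 0 < e -> \forall t \near F, rnorm (l - h t) < e.
Proof.
split=> [/cvgrPdist_lt hl e e0|hl].
  have := hl (ofR e); rewrite ofR_gt0 => /(_ e0).
  by apply: filterS => t; rewrite -ofR_rnorm ofR_lt.
apply/cvgrPdist_lt => e e0; have := hl _ (rl_gt0 e0).
by apply: filterS => t; rewrite -ofR_lt ofR_rnorm ofR_rl // ltW.
Qed.

Lemma bounded_opP (E F : normedModType K) (T : E -> F) : bounded_op E F T <->
  linear T /\ exists C, 0 <= C /\ forall x, rnorm (T x) <= C * rnorm x.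
Proof.
split=> -[lT [C hC]]; split=> //.
  exists (rnorm C); split; first exact: rnorm_ge0.
  move=> x; have Cx := le_trans (normr_ge0 _) (hC x).
  have -> : rnorm C * rnorm x = rl (C * `|x|).
    rewrite -[rnorm C * _]rl_ofR rmorphM /= !ofR_rnorm; congr rl.
    by rewrite -[RHS](ger0_norm Cx) normrM normr_id.
  exact: rl_mono.
have [_ {}hC] := hC; exists (ofR C) => x.
by rewrite -!ofR_rnorm -rmorphM ofR_le.
Qed.

(** Bounding the real part is enough, because [y] may be multiplied by a scalar of modulus one that
    makes [f y] real and nonnegative. *)
Lemma rnorm_functional (E : normedModType K) (f : E -> K) (C : R) : linear f ->
  (forall y, rl (f y) <= C * rnorm y) -> forall y, rnorm (f y) <= C * rnorm y.
Proof.
move=> lf hf y; have [t [t1 ty]] := rotation (f y).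
have <- : rl (f (t *: y)) = rnorm (f y).
  have -> : f (t *: y) = t * f y.
    have l0 : f 0 = 0 by have := lf (-1) 0 0; rewrite scaleN1r oppr0 addr0 => {1}->; rewrite scaleN1r addNr.
    by have := lf t y 0; rewrite !addr0 l0 addr0.
  by rewrite ty.
by apply: le_trans (hf _) _; rewrite rnormZ t1 mul1r.
Qed.

End RealNorm.

Section LinearMaps.
Context {K : numFieldType} {E F : lmodType K} {f : E -> F} (lf : linear f).

Lemma lin0 : f 0 = 0.
Proof. by have := lf (-1) 0 0; rewrite scaleN1r oppr0 addr0 => ->; rewrite scaleN1r addNr. Qed.

Lemma linD x y : f (x + y) = f x + f y.
Proof. by have := lf 1 x y; rewrite !scale1r. Qed.

Lemma linZ a x : f (a *: x) = a *: f x.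
Proof. by have := lf a x 0; rewrite !addr0 lin0 addr0. Qed.

Lemma linN x : f (- x) = - f x.
Proof. by rewrite -scaleN1r linZ scaleN1r. Qed.

Lemma linB x y : f (x - y) = f x - f y.
Proof. by rewrite linD linN. Qed.

Lemma lin_sum (I : Type) (r : seq I) (P : pred I) (G : I -> E) :
  f (\sum_(i <- r | P i) G i) = \sum_(i <- r | P i) f (G i).
Proof. exact: (big_morph f linD lin0). Qed.

End LinearMaps.

(** * Hahn-Banach separation *)

Section HahnBanach.
Context {R : realType} {K : numFieldType} (sc : real_part R K).
Local Notation ofR := (ofR sc).
Local Notation rl := (rl sc).
Local Notation rnorm := (rnorm sc).

(** [supremum] is taken in [K], whose order may be partial. The set consists of images of reals, and
    any upper bound is above the norm of [T 0], hence nonnegative and real; so the least upper bound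
    in [K] is the image of the one in [R]. *)
Lemma opnormP (E F : normedModType K) (T : E -> F) : bounded_op E F T ->
  exists c, [/\ opnorm T = ofR c, 0 <= c,
    forall x, rnorm (T x) <= c * rnorm x &
    forall D, (forall x, rnorm x <= 1 -> rnorm (T x) <= D) -> c <= D].
Proof.
move=> bT; have [lT [C [C0 hC]]] := (bounded_opP sc T).1 bT.
pose A := [set rnorm (T x) | x in [set x | rnorm x <= 1]].
have hA : has_sup A.
  split; first by exists (rnorm (T 0)), 0 => //=; rewrite rnorm0.
  exists C => _ [x /= x1 <-]; apply: le_trans (hC x) _.
  by rewrite -[leRHS]mulr1 ler_wpM2l.
have ball1 x : unit_ball E x <-> rnorm x <= 1.
  by rewrite /unit_ball /= -(ofR_rnorm sc) -(rmorph1 ofR) ofR_le.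
exists (sup A); split.
- rewrite /opnorm /supremum; case: ifPn => [/eqP e|_].
    have : set0 `|T 0|; last by [].
    by rewrite -e; exists 0 => //; apply/ball1; rewrite rnorm0.
  apply: (is_subset1_supremums (A := [set `|T x| | x in unit_ball E])); last first.
    split.
      move=> _ [x /ball1 x1 <-]; rewrite -(ofR_rnorm sc) ofR_le.
      by apply: ub_le_sup; [case: hA|exists x].
    move=> u hu; have u0 : 0 <= u.
      apply: le_trans (hu `|T 0| _) => //; exists 0 => //.
      by apply/ball1; rewrite rnorm0.
    rewrite -(ofR_rl sc u0) ofR_le; apply: ge_sup; first by case: hA.
    move=> _ [x /= x1 <-]; rewrite -(ofR_le sc) ofR_rnorm ofR_rl //.
    by apply: hu; exists x => //; apply/ball1.
  case: xgetP => // /(_ (ofR (sup A))) []; split.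
      move=> _ [x /ball1 x1 <-]; rewrite -(ofR_rnorm sc) ofR_le.
      by apply: ub_le_sup; [case: hA|exists x].
    move=> u hu; have u0 : 0 <= u.
      apply: le_trans (hu `|T 0| _) => //; exists 0 => //.
      by apply/ball1; rewrite rnorm0.
    rewrite -(ofR_rl sc u0) ofR_le; apply: ge_sup; first by case: hA.
    move=> _ [x /= x1 <-]; rewrite -(ofR_le sc) ofR_rnorm ofR_rl //.
    by apply: hu; exists x => //; apply/ball1.
- apply: le_trans (rnorm_ge0 sc (T 0)) _.
  by apply: ub_le_sup; [case: hA|exists 0 => //=; rewrite rnorm0].
- move=> x; have [x0|x0] := eqVneq (rnorm x) 0.
    by rewrite (rnorm_eq0 x0) (lin0 lT) !rnorm0 mulr0.
  have xp : 0 < rnorm x by rewrite lt_def x0 rnorm_ge0.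
  rewrite -ler_pdivrMr // mulrC.
  have -> : (rnorm x)^-1 * rnorm (T x) = rnorm (T (ofR (rnorm x)^-1 *: x)).
    by rewrite (linZ lT) rnormZ rnorm_ofR ger0_norm // invr_ge0 ltW.
  apply: ub_le_sup; first by case: hA.
  exists (ofR (rnorm x)^-1 *: x) => //=.
  by rewrite rnormZ rnorm_ofR ger0_norm ?invr_ge0 ?(ltW xp) // mulVf.
- by move=> D hD; apply: ge_sup; [case: hA|move=> _ [x /= x1 <-]; exact: hD].
Qed.

Definition sublinear (E : lmodType K) (q : E -> R) :=
  (forall x y, q (x + y) <= q x + q y) /\
  (forall a x, 0 <= a -> q (ofR a *: x) <= a * q x).

Section Sublinear.
Context {E : lmodType K}.
Implicit Types (p q : E -> R) (x y : E).

Lemma sublinear_ge0 q : sublinear q -> 0 = q 0.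
Proof.
case=> qD qZ; apply/eqP; rewrite eq_le; apply/andP; split.
  by have := qD 0 0; rewrite addr0; lra.
by have := qZ 0 0 (lexx _); rewrite scaler0 mul0r.
Qed.

Lemma sublinear_lb q x : sublinear q -> - q (- x) <= q x.
Proof.
move=> sq; have [qD _] := sq.
by have := qD x (- x); rewrite subrr -(sublinear_ge0 sq); lra.
Qed.

Lemma sublinearZ q a x : sublinear q -> 0 <= a -> q (ofR a *: x) = a * q x.
Proof.
move=> sq a0; have [qD qZ] := sq; apply/eqP; rewrite eq_le qZ //=.
have [->|an0] := eqVneq a 0.
  by rewrite mul0r rmorph0 scale0r -sublinear_ge0.
have ap : 0 < a by rewrite lt_def an0.
rewrite mulrC -ler_pdivlMr // mulrC.
have := qZ a^-1 (ofR a *: x); rewrite invr_ge0 => /(_ a0).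
by rewrite scalerA -rmorphM mulVf // rmorph1 scale1r.
Qed.

(* The functional is the infimal convolution [inf (q (y + w) - r)] over [W w r]. *)
Lemma sublinear_cone q (W : E -> R -> Prop) : sublinear q ->
  W 0 0 -> (forall v r w s, W v r -> W w s -> W (v + w) (r + s)) ->
  (forall a w r, 0 <= a -> W w r -> W (ofR a *: w) (a * r)) ->
  (forall w r, W w r -> r <= q w) ->
  exists p, [/\ sublinear p, forall x, p x <= q x &
     forall w r, W w r -> p (- w) <= - r].
Proof.
move=> sq W0 WD WZ Wq; have [qD qZ] := sq.
pose A y := [set z | exists w r, W w r /\ z = q (y + w) - r].
have lb y w r : W w r -> - q (- y) <= q (y + w) - r.
  move=> /Wq h; have := qD (y + w) (- y); rewrite addrC addKr; lra.
have hA y : has_inf (A y).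
  split; first by exists (q (y + 0) - 0), 0, 0.
  by exists (- q (- y)) => _ [w [r [h ->]]]; exact: lb.
have Ale y w r : W w r -> inf (A y) <= q (y + w) - r.
  by move=> h; apply: ge_inf; [case: (hA y)|exists w, r].
have leA y c : (forall w r, W w r -> c <= q (y + w) - r) -> c <= inf (A y).
  by move=> h; apply: lb_le_inf; [case: (hA y)|move=> _ [w [r [/h + ->]]]].
exists (fun y => inf (A y)); split; first split.
- move=> x y; rewrite -lerBlDl; apply: (leA) => w r hw.
  rewrite lerBlDl -lerBlDr; apply: (leA) => v s hv.
  have := Ale (x + y) _ _ (WD _ _ _ _ hv hw).
  by have := qD (x + v) (y + w); rewrite addrACA; lra.
- move=> a x a0; have [->|an0] := eqVneq a 0.
    rewrite rmorph0 scale0r mul0r.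
    by have := Ale 0 _ _ W0; rewrite addr0 -sublinear_ge0 // subr0.
  have ap : 0 < a by rewrite lt_def an0.
  rewrite mulrC -ler_pdivrMr //; apply: (leA) => w r hw.
  rewrite ler_pdivrMr // mulrC mulrBr.
  by have := Ale (ofR a *: x) _ _ (WZ _ _ _ a0 hw); rewrite -scalerDr sublinearZ.
- by move=> x; have := Ale x _ _ W0; rewrite addr0 subr0.
- move=> w r hw; have := Ale (- w) _ _ hw.
  by rewrite addNr -(sublinear_ge0 sq) sub0r.
Qed.

(** Zorn's lemma for the reversed pointwise order. The pointwise infimum of a chain is finite,
    because every member is at least [- p (- x)] at [x]. *)
Lemma minimal_sublinear p : sublinear p -> exists g, [/\ sublinear g,
  forall x, g x <= p x &
  forall q, sublinear q -> (forall x, q x <= g x) -> q = g].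
Proof.
move=> sp; pose T := {q | sublinear q /\ forall x, q x <= p x}.
pose le (s t : T) := `[< forall x, sval t x <= sval s x >].
have [||||[g [sg gp]] gmin] := @Zorn T le.
- by move=> t; apply/asboolP.
- move=> r s t /asboolP rs /asboolP st; apply/asboolP => x.
  exact: le_trans (st x) (rs x).
- move=> [s hs] [t ht] /asboolP /= st /asboolP /= ts.
  by apply: eq_exist; apply/funext => x; apply/eqP; rewrite eq_le st ts.
- move=> A Atot; have [A0|/set0P[s0 As0]] := eqVneq A set0.
    by exists (exist _ p (conj sp (fun x => lexx (p x)))) => s; rewrite A0.
  pose B x := [set sval s x | s in A].
  have hB x : has_inf (B x).
    split; first by exists (sval s0 x), s0.
    exists (- p (- x)) => _ [[s [ss sp']] As <-] /=.
    by apply: le_trans (sublinear_lb x ss); rewrite lerN2.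
  have Ble x s : A s -> inf (B x) <= sval s x.
    by move=> h; apply: ge_inf; [case: (hB x)|exists s].
  have leB x c : (forall s, A s -> c <= sval s x) -> c <= inf (B x).
    by move=> h; apply: lb_le_inf; [case: (hB x)|move=> _ [s /h + <-]].
  have sB : sublinear (fun x => inf (B x)) /\ forall x, inf (B x) <= p x.
    split; last by move=> x; apply: le_trans (Ble x _ As0) _; case: (svalP s0).
    split.
      (* Subadditivity of the infimum needs a chain: of the two members used at [x] and at [y], the
         smaller one serves for both. *)
      move=> x y; rewrite -lerBlDl; apply: (leB) => s As.
      rewrite lerBlDl -lerBlDr; apply: (leB) => t At.
      have [[sD _] _] := svalP s; have [[tD _] _] := svalP t.
      have [/asboolP h|/asboolP h] := Atot _ _ As At.
        have := Ble (x + y) _ At; have := tD x y; have := h y; lra.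
      have := Ble (x + y) _ As; have := sD x y; have := h x; lra.
    move=> a x a0; have [->|an0] := eqVneq a 0.
      have [s00 _] := svalP s0; rewrite rmorph0 scale0r mul0r.
      by have := Ble 0 _ As0; rewrite -(sublinear_ge0 s00).
    have ap : 0 < a by rewrite lt_def an0.
    rewrite mulrC -ler_pdivrMr //; apply: (leB) => s As.
    have [ss _] := svalP s; rewrite ler_pdivrMr // mulrC -(sublinearZ _ ss) //.
    exact: Ble.
  by exists (exist _ (fun x => inf (B x)) sB) => s As; apply/asboolP => x; exact: Ble.
exists g; split=> // q sq qg.
have h : sublinear q /\ forall x, q x <= p x.
  by split=> // x; exact: le_trans (qg x) (gp x).
have le_gq : le (exist _ g (conj sg gp)) (exist _ q h) by apply/asboolP.
by have [] := gmin _ le_gq.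
Qed.

(* Hahn-Banach without extension from subspaces: a minimal sublinear functional
   is already linear. *)
Lemma sublinear_dominates p : sublinear p -> exists g : E -> R,
  [/\ forall x y, g (x + y) = g x + g y,
      forall a x, g (ofR a *: x) = a * g x & forall x, g x <= p x].
Proof.
move=> /minimal_sublinear[g [sg gp gmin]]; exists g.
have gN x : g (- x) = - g x.
  (* Convolving [g] with the ray through [x] gives a sublinear functional below [g] whose value at
     [- x] is at most [- g x]; by minimality it is [g] itself. *)
  pose W w r := exists2 t, 0 <= t & w = ofR t *: x /\ r = t * g x.
  have [||||q [sq qg qW]] := @sublinear_cone g W sg.
  - by exists 0 => //; rewrite rmorph0 scale0r mul0r.
  - move=> _ _ _ _ [t t0 [-> ->]] [s s0 [-> ->]]; exists (t + s).
      exact: addr_ge0.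
    by rewrite rmorphD scalerDl mulrDl.
  - move=> a _ _ a0 [t t0 [-> ->]]; exists (a * t); first exact: mulr_ge0.
    by rewrite rmorphM scalerA mulrA.
  - by move=> _ _ [t t0 [-> ->]]; rewrite sublinearZ.
  apply/eqP; rewrite eq_le; apply/andP; split.
    rewrite -[leLHS](congr1 (@^~ (- x)) (gmin _ sq qg)); apply: qW.
    by exists 1 => //; rewrite rmorph1 scale1r mul1r.
  by have := sublinear_lb (- x) sg; rewrite opprK.
have [gD _] := sg; split=> //.
  move=> x y; apply/eqP; rewrite eq_le gD /=.
  by have := gD (- x) (- y); rewrite -opprD !gN; lra.
move=> a x; have [a0|a0] := leP 0 a; first exact: sublinearZ.
by rewrite -[a]opprK rmorphN scaleNr gN sublinearZ ?mulNr //; lra.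
Qed.

End Sublinear.

Lemma sublinear_rnorm (E : normedModType K) : sublinear (fun x : E => rnorm x).
Proof.
split; first exact: rnormD.
by move=> a x a0; rewrite rnormZ rnorm_ofR ger0_norm.
Qed.

(** [W] is the cone generated by [C] placed at height [e]; it lies below the norm because [C] stays
    at distance [e] from 0. The convolution [p] is at most the norm and satisfies [p (- x) <= - e]
    on [C], so a linear functional below [p] is at least [e] there. *)
Lemma separation (E : normedModType K) (C : set E) (e : R) : C !=set0 ->
  (forall x y t, C x -> C y -> 0 <= t <= 1 ->
     C (ofR t *: x + ofR (1 - t) *: y)) ->
  0 <= e -> (forall x, C x -> e <= rnorm x) ->
  exists f : E -> K, [/\ dual E f, forall y, rnorm (f y) <= rnorm y &
    forall x, C x -> e <= rl (f x)].
Proof.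
move=> [c0 Cc0] Ccvx e0 Ce.
pose W w r := exists t c, [/\ 0 <= t, C c, w = ofR t *: c & r = t * e].
have [||||p [sp pn pW]] := @sublinear_cone E _ W (sublinear_rnorm E).
- by exists 0, c0; split=> //; rewrite ?rmorph0 ?scale0r ?mul0r.
- move=> _ _ _ _ [t [c [t0 Cc -> ->]]] [s [d [s0 Cd -> ->]]].
  have [ts0|tsn0] := eqVneq (t + s) 0.
    have -> : t = 0 by lra.
    have -> : s = 0 by lra.
    by exists 0, c0; split=> //; rewrite ?rmorph0 ?scale0r ?mul0r addr0.
  have tsp : 0 < t + s by rewrite lt_def tsn0 addr_ge0.
  exists (t + s), (ofR (t / (t + s)) *: c + ofR (1 - t / (t + s)) *: d).
  split; first exact: addr_ge0.
  + apply: Ccvx => //; rewrite divr_ge0 ?(ltW tsp) //= ler_pdivrMr //; lra.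
  + rewrite scalerDr !scalerA -!rmorphM; congr (ofR _ *: _ + ofR _ *: _);
    by field.
  + by rewrite mulrDl.
- move=> a _ _ a0 [t [c [t0 Cc -> ->]]]; exists (a * t), c.
  by split=> //; rewrite ?mulr_ge0 ?scalerA ?rmorphM ?mulrA.
- move=> _ _ [t [c [t0 Cc -> ->]]]; rewrite rnormZ rnorm_ofR ger0_norm //.
  by rewrite ler_wpM2l // Ce.
have [g [gD gZ gp]] := sublinear_dominates sp.
have [f [lf fg]] := rl_extension gD gZ.
have fn : forall y, rnorm (f y) <= 1 * rnorm y.
  by apply: rnorm_functional => // y; rewrite fg mul1r; exact: le_trans (gp _) (pn _).
exists f; split.
- by apply/(bounded_opP sc); split=> //; exists 1.
- by move=> y; rewrite -[leRHS]mul1r.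
- move=> x Cx; have := pW x e; have := gp (- x).
  rewrite -fg (linN lf) rlN => h1 h2.
  suff : p (- x) <= - e by lra.
  by apply: (h2); exists 1, x; rewrite rmorph1 scale1r mul1r.
Qed.

Lemma norming_functional (E : normedModType K) (x : E) :
  exists f : E -> K, [/\ dual E f, forall y, rnorm (f y) <= rnorm y &
    rl (f x) = rnorm x].
Proof.
have [||||f [df fn fx]] := @separation E [set x] (rnorm x).
- by exists x.
- move=> _ _ t -> -> _ /=.
  by rewrite -scalerDl -rmorphD addrC subrK rmorph1 scale1r.
- exact: rnorm_ge0.
- by move=> _ ->.
exists f; split=> //; apply/eqP; rewrite eq_le fx // andbT.
exact: le_trans (rl_le_rnorm _ _) (fn _).
Qed.

(** Separation of 0 from the coset [x + M]: the real part of [f] is at least [d] on the whole coset,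
    which forces [f] to vanish on [M]. *)
Lemma annihilator (E : normedModType K) (M : set E) (x : E) (d : R) :
  M 0 -> (forall a v w, M v -> M w -> M (a *: v + w)) -> 0 < d ->
  (forall m, M m -> d <= rnorm (x + m)) ->
  exists f : E -> K, [/\ dual E f, forall m, M m -> f m = 0 & f x != 0].
Proof.
move=> M0 ML d0 Md.
have [||||f [df fn fx]] := @separation E [set y | M (y - x)] d.
- by exists x => /=; rewrite subrr.
- move=> y z t /= My Mz _.
  have -> : ofR t *: y + ofR (1 - t) *: z - x =
      ofR t *: (y - x) + (ofR (1 - t) *: (z - x) + 0).
    rewrite addr0 !scalerBr addrACA -opprD -scalerDl -rmorphD [t + _]addrC subrK.
    by rewrite rmorph1 scale1r.
  by apply: (ML) => //; exact: ML.
- exact: ltW.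
- by move=> y /= /Md; rewrite addrC subrK.
have [lf _] := df; have fM m : M m -> d <= rl (f x) + rl (f m).
  by move=> Mm; rewrite -rlD -(linD lf); apply: fx => /=; rewrite addrC addKr.
exists f; split=> //.
  move=> m Mm; have [t [t1 tm]] := rotation sc (f m).
  apply: (rnorm_eq0 (sc := sc)); apply/eqP/negPn/negP => fm0.
  have fmp : 0 < rnorm (f m) by rewrite lt_def fm0 rnorm_ge0.
  (* Adding this multiple of [t *: m] to [x] brings the real part of [f] to 0, against the lower
     bound [d]. *)
  pose a := - rl (f x) / rnorm (f m).
  have := fM (ofR a *: (t *: m) + 0) (ML _ _ _ _ M0).
  rewrite addr0 !(linZ lf) rlM -[t *: f m]/(t * f m) tm -/(rnorm _).
  rewrite -mulrA mulVf // mulr1 subrr.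
  have tM : M (t *: m) by rewrite -[t *: m]addr0; exact: ML.
  by move=> /(_ tM); lra.
have := fM 0 M0; rewrite (lin0 lf) rl0 addr0 => fx0.
by apply/eqP => fx00; rewrite fx00 rl0 in fx0; lra.
Qed.

End HahnBanach.

(** * Operators on reflexive spaces *)

Section Reflexive.
Context {R : realType} {K : numFieldType} (sc : real_part R K).
Local Notation ofR := (ofR sc).
Local Notation rl := (rl sc).
Local Notation rnorm := (rnorm sc).

Lemma filter2_ex (T : Type) (U : set_system T) (PU : ProperFilter U)
    (P Q : set T) : U P -> U Q -> exists t, P t /\ Q t.
Proof. by move=> UP UQ; exact: (filter_ex (filterI UP UQ)). Qed.

Lemma near_lim_uniq (E : normedModType K) (T : Type) (U : set_system T)
    (PU : ProperFilter U) (h : T -> E) (x y : E) :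
  (forall e : R, 0 < e -> \forall t \near U, rnorm (h t - x) < e) ->
  (forall e : R, 0 < e -> \forall t \near U, rnorm (h t - y) < e) -> x = y.
Proof.
move=> hx hy; apply/eqP; rewrite -subr_eq0; apply/eqP.
apply: (rnorm_eq0 (sc := sc)); apply/eqP/negPn/negP => n0.
have e0 : 0 < rnorm (x - y) / 2.
  by have := rnorm_ge0 sc (x - y); rewrite le_eqVlt eq_sym (negPf n0) /=; lra.
have [t [/= h1 h2]] := filter2_ex PU (hx _ e0) (hy _ e0).
have := rnorm_triangle sc x (h t) y; rewrite [in rnorm (x - h t)]rnormBC; lra.
Qed.

Lemma near_rnorm_le (E : normedModType K) (T : Type) (U : set_system T)
    (PU : ProperFilter U) (h : T -> E) (x : E) (M : R) :
  (forall e : R, 0 < e -> \forall t \near U, rnorm (h t - x) < e) ->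
  (\forall t \near U, rnorm (h t) <= M) -> rnorm x <= M.
Proof.
move=> hx hM; apply/ler_addgt0Pl => e e0.
have [t [/= h1 h2]] := filter2_ex PU (hx _ e0) hM.
have := rnormB sc (h t) (h t - x); rewrite subKr; lra.
Qed.

Lemma near_lin (E F : normedModType K) (T : Type) (U : set_system T)
    (PU : ProperFilter U) (h : T -> E) (x : E) (f : E -> F) :
  bounded_op E F f ->
  (forall e : R, 0 < e -> \forall t \near U, rnorm (h t - x) < e) ->
  (forall e : R, 0 < e -> \forall t \near U, rnorm (f (h t) - f x) < e).
Proof.
move=> /(bounded_opP sc)[lf [C [C0 hC]]] hx e e0.
have C1 : 0 < C + 1 by lra.
have := hx (e / (C + 1)) (divr_gt0 e0 C1).
apply: filterS => t; rewrite ltr_pdivlMr // -(linB lf) => ht.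
by apply: le_lt_trans (hC _) _; have := rnorm_ge0 sc (h t - x); nra.
Qed.

(** Weak compactness of balls: the limits along [U] of the scalars [f (h t)] define an element of
    the bidual, which reflexivity represents by a point; a norming functional of that point
    transfers the bound [M]. *)
Lemma reflexive_ultra (E : normedModType K) (T : Type) (U : set_system T)
    (UU : UltraFilter U) (h : T -> E) (M : R) : reflexive_space E ->
  (forall t, rnorm (h t) <= M) ->
  exists x, rnorm x <= M /\ forall f, dual E f ->
    forall e : R, 0 < e -> \forall t \near U, rnorm (f (h t) - f x) < e.
Proof.
move=> rE hM.
pose L (f : E -> K) := [set l : K | forall e : R, 0 < e ->
  \forall t \near U, rnorm (f (h t) - l) < e].
have M0 : 0 <= M.
  have [t _] := filter_ex (@filterT _ U _).
  exact: le_trans (rnorm_ge0 sc (h t)) (hM t).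
have exL f : dual E f -> exists l, L f l.
  move=> /opnormP-/(_ _ sc)[c [_ c0 hc _]].
  apply: (ultra_scalars (M := c * M)) => //; apply: nearW => t.
  by apply: le_trans (hc _) _; rewrite ler_wpM2l.
(* The default 0 can occur only for [f] outside the dual, where [bidual] imposes nothing. *)
pose Phi f := xget 0 (L f).
have LPhi f : dual E f -> L f (Phi f).
  by move=> /exL[l hl]; apply: (xgetPex 0); exists l.
have [|x hx] := rE Phi.
- split.
    move=> a f g df dg.
    have dfg : L (a *: f + g) (a * Phi f + Phi g).
      move=> e e0; have a1 : 0 < rnorm a + 1 by have := rnorm_ge0 sc a; lra.
      have e2 : 0 < e / 2 by lra.
      have := LPhi g dg _ e2; have := LPhi f df _ (divr_gt0 e2 a1).
      apply: filterS2 => t; rewrite ltr_pdivlMr // => h1 h2.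
      rewrite (_ : _ - _ = a * (f (h t) - Phi f) + (g (h t) - Phi g)).
        apply: le_lt_trans (rnormD _ _ _) _; rewrite rnormM.
        have := rnorm_ge0 sc a; have := rnorm_ge0 sc (f (h t) - Phi f); nra.
      by rewrite (_ : (a *: f + g) (h t) = a * f (h t) + g (h t)) //; ring.
    have dfg' : L (a *: f + g) (Phi (a *: f + g)).
      by apply: (xgetPex 0); exists (a * Phi f + Phi g).
    exact: (@near_lim_uniq K T U _ (fun t => (a *: f + g) (h t))).
  exists (ofR M) => f df; have [c [-> c0 hc _]] := opnormP sc df.
  rewrite -(ofR_rnorm sc) -rmorphM ofR_le.
  apply: (@near_rnorm_le K T U _ (fun t => f (h t))); first exact: LPhi.
  apply: nearW => t; apply: le_trans (hc _) _.
  by rewrite mulrC ler_wpM2r.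
exists x; split; last by move=> f df; have := LPhi f df; rewrite hx.
have [f [df fn <-]] := norming_functional sc x.
apply: le_trans (rl_le_rnorm _ _) _.
apply: (@near_rnorm_le K T U _ (fun t => f (h t))).
  by have := LPhi f df; rewrite hx.
by apply: nearW => t; exact: le_trans (fn _) (hM t).
Qed.

Lemma compact_near_cvg (E : normedModType K) (A : set E) (T : Type)
    (U : set_system T) (UU : UltraFilter U) (h : T -> E) : compact A ->
  (forall t, A (h t)) ->
  exists y, forall e : R, 0 < e -> \forall t \near U, rnorm (h t - y) < e.
Proof.
move=> cA hA.
have [y [_ yc]] := cA (h @ U) _ (filterS (fun t _ => hA t) (@filterT _ U _)).
exists y => e e0.
have [hn|hn] := in_ultra_setVsetC (fun t => rnorm (h t - y) < e) UU.
  exact: hn.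
have hb : (h @ U) [set z : E | e <= rnorm (z - y)].
  by apply: filterS hn => t /= ht; rewrite leNgt; apply/negP; exact: ht.
have [|z [/= hz]] := yc _ (ball y (ofR e)) hb.
  by apply: nbhsx_ballx; rewrite ofR_gt0.
rewrite -ball_normE /= -(ofR_rnorm sc) ofR_lt rnormBC => /lt_le_trans/(_ hz).
by rewrite ltxx.
Qed.

Lemma comp_dual (E F : normedModType K) (T : E -> F) (f : F -> K) :
  bounded_op E F T -> dual F f -> dual E (f \o T).
Proof.
move=> /(bounded_opP sc)[lT [C [C0 hC]]] /(bounded_opP sc)[lf [D [D0 hD]]].
apply/(bounded_opP sc); split.
  by move=> a x y /=; rewrite (linD lT) (linZ lT) (linD lf) (linZ lf).
exists (D * C); split=> [|x /=]; first exact: mulr_ge0.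
by apply: le_trans (hD _) _; rewrite -mulrA ler_wpM2l.
Qed.

Lemma dual_eq (F : normedModType K) (x y : F) :
  (forall f, dual F f -> f x = f y) -> x = y.
Proof.
move=> h; apply/eqP; rewrite -subr_eq0; apply/eqP.
apply: (rnorm_eq0 (sc := sc)).
have [f [df _ <-]] := norming_functional sc (x - y).
by rewrite (linB (proj1 df)) h // subrr rl0.
Qed.

Lemma compact_norm_attaining (E F : completeNormedModType K) (T : E -> F) :
  reflexive_space E -> compact_op E F T -> norm_attaining E F T.
Proof.
move=> rE [bT pT]; split=> //; move: pT; rewrite precompactE => cT.
have [c [-> c0 hc cmin]] := opnormP sc bT.
have /choice[x hx] (n : nat) : exists x, rnorm x <= 1 /\ c - n.+1%:R^-1 < rnorm (T x).
  apply: contrapT => /forallNP hn.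
  have : c <= c - n.+1%:R^-1.
    apply: cmin => x x1; rewrite leNgt; apply/negP => hx.
    by apply: (hn x).
  by rewrite leNgt ltrBlDr ltrDl invr_gt0 ltr0Sn.
have [U [UU sU]] := ultraFilterLemma (@eventually_filter).
have xA n : closure (T @` unit_ball E) (T (x n)).
  apply: subset_closure; exists (x n) => //.
  by rewrite /unit_ball /= -(ofR_rnorm sc) -(rmorph1 ofR) ofR_le; case: (hx n).
have [y hy] := @compact_near_cvg F _ nat U UU (T \o x) cT xA.
have [z [z1 hz]] := @reflexive_ultra E nat U UU x 1 rE (fun n => (hx n).1).
(* Along the same [U], the scalars [f (T (x n))] tend to [f (T z)] by the weak limit and to [f y] by
   the norm limit. *)
have Tz : T z = y.
  apply: dual_eq => f df.
  apply: (@near_lim_uniq K nat U _ (fun n => f (T (x n)))).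
    exact: hz (comp_dual bT df).
  exact: (near_lin _ df hy).
exists z; first by rewrite /unit_ball /= -(ofR_rnorm sc) -(rmorph1 ofR) ofR_le.
rewrite -(ofR_rnorm sc); congr (ofR _); apply/eqP; rewrite eq_le; apply/andP; split.
  by apply: le_trans (hc _) _; rewrite -[leRHS]mulr1 ler_wpM2l.
rewrite Tz; apply/ler_addgt0Pl => e e0.
have e2 : 0 < e / 2 by lra.
have hn : \forall n \near U, n.+1%:R^-1 < e / 2.
  apply: sU; have := @near_infty_natSinv_lt R (PosNum e2).
  by apply.
have [n [/= h1 h2]] := filter2_ex _ (hy _ e2) hn.
have := rnormD sc (T (x n) - y) y; rewrite subrK.
have [_] := hx n; move: h1 h2 => /=; move: (n.+1%:R^-1) => i; lra.
Qed.

End Reflexive.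

(** * Weak sequential compactness and precompactness *)

Section WeakCompactness.
Context {R : realType} {K : numFieldType} (sc : real_part R K).
Local Notation ofR := (ofR sc).
Local Notation rl := (rl sc).
Local Notation rnorm := (rnorm sc).

(** The coefficients form an infinite sequence vanishing from [n] on, so that two combinations can
    be rewritten over a common range and added. *)
Definition finite_span (E : lmodType K) (x : nat -> E) : set E :=
  [set m | exists n (a : nat -> K), (forall i, (n <= i)%N -> a i = 0) /\
     m = \sum_(i < n) a i *: x i].

Lemma finite_span0 (E : lmodType K) (x : nat -> E) : finite_span x 0.
Proof. by exists 0%N, (fun=> 0); rewrite big_ord0. Qed.

Lemma finite_span_lin (E : lmodType K) (x : nat -> E) (a : K) (v w : E) :
  finite_span x v -> finite_span x w -> finite_span x (a *: v + w).
Proof.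
have ext n m (b : nat -> K) : (n <= m)%N -> (forall i, (n <= i)%N -> b i = 0) ->
    \sum_(i < n) b i *: x i = \sum_(i < m) b i *: x i.
  move=> nm b0; rewrite (big_ord_widen m (fun i => b i *: x i) nm) big_mkcond /=.
  by apply: eq_bigr => i _; case: ltnP => // /b0 ->; rewrite scale0r.
move=> [n [b [b0 ->]]] [m [c [c0 ->]]].
exists (maxn n m), (fun i => a * b i + c i); split.
  by move=> i; rewrite geq_max => /andP[/b0 -> /c0 ->]; rewrite mulr0 addr0.
rewrite (ext n (maxn n m)) ?leq_maxl // (ext m (maxn n m)) ?leq_maxr //.
rewrite scaler_sumr -big_split; apply: eq_bigr => i _ /=.
by rewrite scalerA scalerDl.
Qed.

Lemma finite_span_mem (E : lmodType K) (x : nat -> E) n : finite_span x (x n).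
Proof.
exists n.+1, (fun i => (i == n)%:R); split.
  by move=> i ni; rewrite gtn_eqF.
rewrite big_ord_recr /= eqxx scale1r big1 ?add0r // => i _.
by rewrite ltn_eqF // scale0r.
Qed.

(** Combinations with coefficients in a countable dense set of scalars approximate the whole span.
    They are coded by finite lists of indices, and each receives a norming functional. *)
Lemma countable_norming (E : normedModType K) (x : nat -> E) (M : R) :
  (forall n, rnorm (x n) <= M) ->
  exists f : nat -> E -> K, [/\ forall j, dual E (f j),
    forall j y, rnorm (f j y) <= rnorm y &
    forall m d, finite_span x m -> 0 < d ->
      exists j c, rnorm (m - c) < d /\ rl (f j c) = rnorm c].
Proof.
move=> hM; have [q hq] := dense_scalars sc.
pose c (s : seq nat) := \sum_(i < size s) q (nth 0%N s i) *: x i.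
have /choice[g hg] (s : seq nat) := norming_functional sc (c s).
exists (fun j => g (odflt [::] (unpickle j))); split.
- by move=> j; case: (hg (odflt [::] (unpickle j))).
- by move=> j; case: (hg (odflt [::] (unpickle j))).
move=> _ d [n [a [_ ->]]] d0.
have M0 : 0 <= M := le_trans (rnorm_ge0 sc (x 0%N)) (hM 0%N).
have D0 : 0 < n.+1%:R * (M + 1) by rewrite mulr_gt0 // ltr_wpDl.
(* With this precision each of the [n] terms contributes at most [d / n.+1], so the total stays
   strictly below [d]. *)
have /choice[s hs] (i : nat) := hq (a i) _ (divr_gt0 d0 D0).
exists (pickle (mkseq s n)), (c (mkseq s n)); rewrite pickleK /=.
split; last by have [] := hg (mkseq s n).
rewrite /c size_mkseq -sumrB.
apply: le_lt_trans (rnorm_sum _ _ _ _) _.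
have : \sum_(i < n) rnorm (a i *: x i - q (nth 0%N (mkseq s n) i) *: x i) <=
    \sum_(i < n) d / n.+1%:R.
  apply: ler_sum => i _; rewrite -scalerBl rnormZ nth_mkseq //.
  have h := hs i; have := hM i.
  have -> : d / n.+1%:R = d / (n.+1%:R * (M + 1)) * (M + 1).
    by rewrite invfM mulrA divfK // gt_eqF // ltr_wpDl.
  move=> hx; apply: ler_pM => //; rewrite ?rnorm_ge0 //; first exact: ltW h.
  by apply: le_trans hx _; rewrite lerDl.
rewrite sumr_const card_ord => h; apply: le_lt_trans h _.
rewrite -[_ *+ n]mulr_natr -mulrA -[ltRHS]mulr1 ltr_pM2l //.
by rewrite mulrC ltr_pdivrMr // mul1r ltr_nat.
Qed.

(* Weak cluster points of a subsequence converging on a norming sequence of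
   functionals lie in the closed span of [x], hence agree; being phrased with
   limits along ultrafilters, this avoids the weak topology. *)
Lemma weak_subsequence (E : normedModType K) (x : nat -> E) (M : R) :
  reflexive_space E -> (forall n, rnorm (x n) <= M) ->
  exists (n : nat -> nat) z, (forall k, (k <= n k)%N) /\
    weakly_cvg_to (x \o n) z.
Proof.
move=> rE hM; have [f [df fn fc]] := countable_norming hM.
have [U [UU sU]] := ultraFilterLemma (@eventually_filter).
have [z [zM hz]] := reflexive_ultra UU rE hM.
(* Diagonal choice: stage [k] constrains finitely many functionals, so the set of admissible indices
   belongs to [U]. *)
have /choice[n hn] (k : nat) : exists n, (k <= n)%N /\
    forall j : 'I_k, rnorm (f j (x n) - f j z) < k.+1%:R^-1.
  apply: (@filter2_ex _ U); first by apply: sU; exact: nbhs_infty_ge.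
  by apply: filter_forall => j; apply: (hz _ (df j)); rewrite invr_gt0 ltr0Sn.
exists n, z; split; first by move=> k; case: (hn k).
move=> g dg; apply/(cvg_rnorm sc) => e e0; apply: contrapT => ng.
(* An ultrafilter [W] concentrated on the bad indices [D] gives a second weak limit [y], with [g y]
   different from [g z]; the contradiction will be [y = z]. *)
pose D := [set k | e <= rnorm (g z - g (x (n k)))].
pose V := within D \oo.
have PV : ProperFilter V.
  apply: Build_ProperFilter.
  rewrite /V /within /= => h; apply: ng; apply: filterS h => k /= hk.
  by rewrite ltNge; apply/negP.
have [W [UW sW]] := ultraFilterLemma PV.
have oW : \oo `<=` W.
  by move=> A hA; apply: sW; rewrite /V /within /=; apply: filterS hA.
have [y [yM hy]] := reflexive_ultra UW rE (fun k => hM (n k)).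
have fyz j : f j y = f j z.
  apply: (@near_lim_uniq R K sc K nat W _ (fun k => f j (x (n k)))).
    by apply: hy.
  move=> d d0.
  have h1 : \forall k \near W, k.+1%:R^-1 < d.
    by apply: oW; exact: (near_infty_natSinv_lt (PosNum d0)).
  have h2 : \forall k \near W, (j < k)%N by apply: oW; exact: nbhs_infty_gt.
  apply: filterS2 h1 h2 => k k1 jk.
  by have [_ /(_ (Ordinal jk)) /= h] := hn k; exact: lt_trans h k1.
have yz : y - z = 0.
  apply: (rnorm_eq0 (sc := sc)); apply/eqP/negPn/negP => yz0.
  pose d := rnorm (y - z) / 4.
  have d0 : 0 < d by rewrite divr_gt0 // lt_def yz0 rnorm_ge0.
  (* Otherwise some functional would vanish on every [x n] but not at [y - z], although its values
     at [y] and [z] are limits of zeros. *)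
  have [m [xm ym]] : exists m, finite_span x m /\ rnorm (y - z + m) < d.
    apply: contrapT => /forallNP hm.
    have [||m xm|h [dh hx]] := @annihilator R K sc E (finite_span x) (y - z) d _ _ d0.
    - exact: finite_span0.
    - exact: finite_span_lin.
    - by rewrite leNgt; apply/negP => ?; apply: (hm m).
    rewrite (linB (proj1 dh)).
    have -> : h y = 0.
      apply: (@near_lim_uniq R K sc K nat W _ (fun k => h (x (n k)))).
        exact: hy.
      move=> e' e0'; apply: nearW => k; rewrite hx ?subrr ?rnorm0 //.
      exact: finite_span_mem.
    have -> : h z = 0.
      apply: (@near_lim_uniq R K sc K nat U _ (fun k => h (x k))).
        exact: hz.
      move=> e' e0'; apply: nearW => k; rewrite hx ?subrr ?rnorm0 //.
      exact: finite_span_mem.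
    by rewrite subrr eqxx.
  have xmN : finite_span x (- m).
    by rewrite -scaleN1r -[_ *: m]addr0; apply: finite_span_lin => //; exact: finite_span0.
  have [j [c [mc fjc]]] := fc _ _ xmN d0.
  (* [f j] kills [y - z] and norms [c], so the norm of [c] is at most that of [y - z - c], which is
     below [2 * d]. Hence [y - z] has norm below [4 * d], which is its own norm. *)
  have h1 : rnorm (y - z - c) < 2 * d.
    apply: le_lt_trans (rnorm_triangle _ _ (- m) _) _; rewrite opprK; lra.
  have h2 : rnorm c <= rnorm (y - z - c).
    rewrite -fjc rnormBC; apply: le_trans (fn j _).
    rewrite !(linB (proj1 (df j))) fyz subrr subr0.
    exact: rl_le_rnorm.
  have := rnormD sc (y - z - c) c; rewrite subrK /d in h1 h2 *; lra.
have [k [h1 h2]] : exists k, D k /\ rnorm (g (x (n k)) - g y) < e.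
  apply: (@filter2_ex _ W); last exact: hy.
  by apply: sW; rewrite /V /within /=; apply: nearW.
move: h1; rewrite /D /= rnormBC.
have -> : z = y by apply/eqP; rewrite eq_sym -subr_eq0 yz.
by move=> /le_lt_trans/(_ h2); rewrite ltxx.
Qed.

(** Without a finite net, a point of [A] at distance at least [e] from all previous ones could be
    chosen forever; [L n] lists the first [n] choices. *)
Lemma finite_net (E : normedModType K) (A : set E) (e : R) :
  (forall u : nat -> E, (forall n, A (u n)) ->
     exists m n, (m < n)%N /\ rnorm (u m - u n) < e) ->
  exists s : seq E, forall a, A a -> exists2 z, z \in s & rnorm (a - z) < e.
Proof.
move=> hA; apply: contrapT => /forallNP hs.
have /choice[phi hphi] (s : seq E) :
    exists a, A a /\ forall z, z \in s -> e <= rnorm (a - z).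
  apply: contrapT => /forallNP h; apply: (hs s) => a Aa.
  apply: contrapT => /forall2NP h'; apply: (h a); split=> // z zs.
  by have [//|/negP] := h' z; rewrite -leNgt.
pose L := fix L n := if n is n'.+1 then phi (L n') :: L n' else [::].
have inL m n : (m < n)%N -> phi (L m) \in L n.
  elim: n => // n IH; rewrite ltnS leq_eqVlt => /orP[/eqP ->|/IH h] /=.
    by rewrite mem_head.
  by rewrite inE h orbT.
have [m [n [mn]]] := hA (fun n => phi (L n)) (fun n => (hphi (L n)).1).
by rewrite rnormBC ltNge => /negP; apply; apply: (hphi (L n)).2; exact: inL.
Qed.

Lemma precompact_sequences (F : completeNormedModType K) (A : set F) :
  (forall e : R, 0 < e -> forall u : nat -> F, (forall n, A (u n)) ->
     exists m n, (m < n)%N /\ rnorm (u m - u n) < e) ->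
  precompact A.
Proof.
move=> hA; rewrite precompactE compact_ultra => U UU UA.
suff /cauchy_cvgP/cvg_ex[p Up] : cauchy U.
  by exists p; split=> //; exact: (@closed_cvg _ _ U _ id (closure A) (@closed_closure _ A) UA p Up).
apply: cauchy_exP => e e0.
have e2 : 0 < rl e / 2 by rewrite divr_gt0 // rl_gt0.
have [s hs] := finite_net (hA _ e2).
apply: contrapT => /forallNP hn.
have hU : U [set a | forall z, z \in s -> ~ ball z e a].
  elim: s {hs} => [|z s IH]; first by apply: filterS filterT.
  have [//|/(filterI IH)] := in_ultra_setVsetC (ball z e) UU; first by move/hn.
  apply: filterS => a [h1 h2] w; rewrite inE => /orP[/eqP -> //|]; exact: h1.
have [a [Aa ha]] := filter2_ex _ UA hU.
have [|b [Ab]] := Aa (ball a (ofR (rl e / 2))).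
  by apply: nbhsx_ballx; rewrite ofR_gt0.
rewrite -ball_normE /= -(ofR_rnorm sc) ofR_lt => ab.
have [z zs bz] := hs b Ab; apply: (ha z zs).
rewrite -ball_normE /= -(ofR_rnorm sc) -(ofR_rl sc (ltW e0)) ofR_lt rnormBC.
by have := rnorm_triangle sc a b z; lra.
Qed.

Lemma schur_compact (E F : completeNormedModType K) (T : E -> F) :
  schur_property F -> reflexive_space E -> bounded_op E F T -> compact_op E F T.
Proof.
move=> sF rE bT; split=> //; apply: precompact_sequences => e e0 u hu.
have /choice[x hx] (n : nat) : exists x, unit_ball E x /\ T x = u n.
  by have [x] := hu n; exists x.
have x1 n : rnorm (x n) <= 1.
  by rewrite -(ofR_le sc) ofR_rnorm rmorph1; case: (hx n).
have [n [z [kn nz]]] := weak_subsequence rE x1.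
have /cvg_ex[y uy] : cvgn (fun k => T (x (n k))).
  by apply: sF; exists (T z) => f df; exact: nz (comp_dual sc bT df).
have e2 : 0 < e / 2 by lra.
have [N _ hN] := (cvg_rnorm sc _ _ _).1 uy _ e2.
(* All that is known of [n] is [k <= n k]; evaluating it at [(n N).+1] makes the second index exceed
   the first. *)
exists (n N), (n (n N).+1); split; first exact: leq_trans (kn _).
have h1 := hN N (leqnn _).
have h2 := hN (n N).+1 (leq_trans (kn N) (leqnSn _)).
move: h1 h2; rewrite /= !(hx _).2 => h1 h2.
have := rnorm_triangle sc (u (n N)) y (u (n (n N).+1)).
by rewrite [in X in _ <= X -> _]rnormBC; lra.
Qed.

End WeakCompactness.

(** * Banach spaces of sequences *)

(** The norm will be the supremum over [m] of the [sn m]. Dependence on finitely many coordinates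
    lets each [sn m] pass to coordinatewise limits, which yields completeness; control of the
    coordinates gives definiteness and the existence of those limits. *)
Record seqnorm (R : realType) (K : numFieldType) (sc : real_part R K) :=
  SeqNorm {
  sn : nat -> (nat -> K) -> R;
  snD : forall m a b, sn m (a + b) <= sn m a + sn m b;
  snZ : forall m c a, sn m (c *: a) = rnorm sc c * sn m a;
  sn_le_coord : forall m, exists (C : R) k, 0 <= C /\
    forall a, sn m a <= C * \sum_(i < k) rnorm sc (a i);
  coord_le_sn : forall i, exists m (C : R), 0 <= C /\
    forall a, rnorm sc (a i) <= C * sn m a }.

Section SequenceSpace.
Context {R : realType} {K : numFieldType} {sc : real_part R K}.
Variable p : seqnorm sc.
Local Notation ofR := (ofR sc).
Local Notation rl := (rl sc).
Local Notation rnorm := (rnorm sc).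
Implicit Types a b : nat -> K.

Lemma sn0 m : sn p m 0 = 0.
Proof. by rewrite -(scale0r 0) snZ rnorm0 mul0r. Qed.

Lemma snN m a : sn p m (- a) = sn p m a.
Proof. by rewrite -scaleN1r snZ rnormN rnorm1 mul1r. Qed.

Lemma sn_ge0 m a : 0 <= sn p m a.
Proof. by have := snD p m a (- a); rewrite subrr sn0 snN; lra. Qed.

Definition seqdom : {pred nat -> K} :=
  fun a => `[< exists C, forall m, sn p m a <= C >].

Lemma seqdomP a : reflect (exists C, forall m, sn p m a <= C) (a \in seqdom).
Proof. exact: asboolP. Qed.

Fact seqdom_submod_closed : submod_closed seqdom.
Proof.
split; first by apply/seqdomP; exists 0 => m; rewrite sn0.
move=> c a b /seqdomP[C hC] /seqdomP[D hD]; apply/seqdomP.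
exists (rnorm c * C + D) => m; apply: le_trans (snD _ _ _ _) _.
by rewrite snZ lerD // ler_wpM2l // rnorm_ge0.
Qed.

HB.instance Definition _ :=
  GRing.isSubmodClosed.Build K (nat -> K) seqdom seqdom_submod_closed.

Record seqspace := SeqSpace { coords :> nat -> K; _ : coords \in seqdom }.

HB.instance Definition _ := [isSub for coords].
HB.instance Definition _ := [Choice of seqspace by <:].
HB.instance Definition _ := [SubChoice_isSubLmodule of seqspace by <:].

Definition seqspace_norm (v : seqspace) : R :=
  sup [set sn p m (coords v) | m in setT].

Lemma sn_le_norm m (v : seqspace) : sn p m v <= seqspace_norm v.
Proof.
apply: ub_le_sup; last by exists m.
by have /seqdomP[C hC] := valP v; exists C => _ [k _ <-].
Qed.

Lemma norm_le_sn (v : seqspace) (C : R) :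
  (forall m, sn p m v <= C) -> seqspace_norm v <= C.
Proof.
by move=> hC; apply: ge_sup => [|_ [m _ <-]]; [exists (sn p 0 v), 0%N|].
Qed.

Lemma seqspace_norm_ge0 (v : seqspace) : 0 <= seqspace_norm v.
Proof. exact: le_trans (sn_ge0 0 v) (sn_le_norm 0 v). Qed.

Fact seqspace_normD (v w : seqspace) :
  ofR (seqspace_norm (v + w)) <= ofR (seqspace_norm v) + ofR (seqspace_norm w).
Proof.
rewrite -rmorphD ofR_le; apply: norm_le_sn => m.
by apply: le_trans (snD _ _ _ _) _; apply: lerD; exact: sn_le_norm.
Qed.

Fact seqspace_normZ (c : K) (v : seqspace) :
  ofR (seqspace_norm (c *: v)) = `|c| * ofR (seqspace_norm v).
Proof.
have le d w : seqspace_norm (d *: w) <= rnorm d * seqspace_norm w.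
  apply: norm_le_sn => m; rewrite [sn _ _ _]snZ.
  by rewrite ler_wpM2l ?rnorm_ge0 // sn_le_norm.
rewrite -(ofR_rnorm sc) -rmorphM; congr (ofR _); apply/eqP.
rewrite eq_le le /=; have [->|c0] := eqVneq c 0.
  by rewrite rnorm0 mul0r seqspace_norm_ge0.
have cp : 0 < rnorm c.
  by rewrite lt_def rnorm_ge0 andbT; apply/eqP => /rnorm_eq0/eqP; rewrite (negPf c0).
have := le c^-1 (c *: v); rewrite scalerA mulVf // scale1r => h.
have cV : rnorm c * rnorm c^-1 = 1 by rewrite -rnormM mulfV // rnorm1.
have := ler_wpM2l (ltW cp) h; by rewrite mulrA cV mul1r.
Qed.

Fact seqspace_norm_eq0 (v : seqspace) : ofR (seqspace_norm v) = 0 -> v = 0.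
Proof.
move=> /eqP; rewrite fmorph_eq0 => /eqP v0; apply: val_inj; apply/funext => i /=.
have [m [C [C0 hC]]] := coord_le_sn p i; apply: (rnorm_eq0 (sc := sc)).
apply/eqP; rewrite eq_le rnorm_ge0 andbT; apply: le_trans (hC _) _.
by rewrite -(mulr0 C) ler_wpM2l // -v0 sn_le_norm.
Qed.

HB.instance Definition _ := Lmodule_isNormed.Build K seqspace
  seqspace_normD seqspace_normZ seqspace_norm_eq0.

Lemma rnorm_seqspace (v : seqspace) : rnorm v = seqspace_norm v.
Proof. exact: rl_ofR. Qed.

Lemma sn_le_rnorm m (v : seqspace) : sn p m v <= rnorm v.
Proof. by rewrite rnorm_seqspace sn_le_norm. Qed.

Lemma rnorm_le_sn (v : seqspace) (C : R) :
  (forall m, sn p m v <= C) -> rnorm v <= C.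
Proof. by rewrite rnorm_seqspace; exact: norm_le_sn. Qed.

(** Completeness of the scalars, drawn from [ultra_scalars]: a Cauchy filter converges to its limit
    along any finer ultrafilter. *)
Lemma cauchy_near_scalars (T : Type) (F : set_system T) (PF : ProperFilter F)
    (h : T -> K) :
  (forall e : R, 0 < e -> exists2 A, F A & forall s t, A s -> A t -> rnorm (h s - h t) < e) ->
  exists l, forall e : R, 0 < e -> \forall t \near F, rnorm (h t - l) < e.
Proof.
move=> hF; have [U [UU FU]] := ultraFilterLemma PF.
have [A FA hA] := hF 1 ltr01.
have [s As] := filter_ex FA.
have [|l hl] := @ultra_scalars _ _ sc T U h (rnorm (h s) + 1) UU.
  apply: FU; apply: filterS FA => t At.
  have := rnormD sc (h t - h s) (h s); rewrite subrK -/(rnorm _).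
  by have := hA _ _ At As; lra.
exists l => e e0; have e2 : 0 < e / 2 by lra.
have [B FB hB] := hF _ e2.
apply: (filterS _ FB) => t Bt.
have [r [Br hr]] := filter2_ex _ (FU _ FB) (hl _ e2).
have := rnorm_triangle sc (h t) (h r) l; have := hB _ _ Bt Br.
by rewrite -/(rnorm _) in hr *; lra.
Qed.

Fact seqspace_complete (F : set_system seqspace) :
  ProperFilter F -> cauchy F -> cvg F.
Proof.
move=> PF /cauchyP cF.
have {}cF (e : R) : 0 < e ->
    exists2 A, F A & forall s t, A s -> A t -> rnorm (s - t) < e.
  move=> e0; have [|x Fx] := cF (ofR (e / 2)); first by rewrite ofR_gt0; lra.
  exists (ball x (ofR (e / 2))) => // s t.
  rewrite -ball_normE /= -!(ofR_rnorm sc) !ofR_lt [rnorm (x - s)]rnormBC => hs ht.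
  by have := rnorm_triangle sc s x t; lra.
have /choice[l hl] (i : nat) : exists l, forall e : R, 0 < e ->
    \forall v \near F, rnorm (coords v i - l) < e.
  apply: cauchy_near_scalars => e e0.
  have [m [C [C0 hC]]] := coord_le_sn p i.
  have C1 : 0 < C + 1 by lra.
  have [A FA hA] := cF _ (divr_gt0 e0 C1); exists A => // s t As At.
  apply: le_lt_trans (hC (coords (s - t))) _.
  have := hA _ _ As At; rewrite ltr_pdivlMr // => h.
  have := sn_le_rnorm m (s - t); have := rnorm_ge0 sc (s - t); nra.
(* For fixed [m], some [w] in [A] is close to [l] in the finitely many coordinates that [sn m] sees.
   The resulting bound [e] does not depend on [m], as the supremum requires. *)
have key (e : R) (A : set seqspace) : F A ->
    (forall s t, A s -> A t -> rnorm (s - t) < e) ->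
    forall v m, A v -> sn p m (coords v - l) <= e.
  move=> FA hA v m Av; apply/ler_addgt0Pl => d d0.
  have [C [k [C0 hC]]] := sn_le_coord p m.
  have D0 : 0 < (C + 1) * k.+1%:R by rewrite mulr_gt0 // ltr_wpDl.
  have hk : \forall w \near F, forall i : 'I_k,
      rnorm (coords w i - l i) < d / ((C + 1) * k.+1%:R).
    by apply: filter_forall => i; apply: hl; exact: divr_gt0.
  have [w [Aw hw]] := filter2_ex _ FA hk.
  have -> : coords v - l = coords (v - w) + (coords w - l).
    by rewrite [coords (v - w)]/(coords v - coords w) addrA subrK.
  apply: le_trans (snD _ _ _ _) _; rewrite addrC lerD //; last first.
    by apply: le_trans (sn_le_rnorm _ _) _; exact/ltW/hA.
  apply: le_trans (hC _) _.
  have : \sum_(i < k) rnorm ((coords w - l) i) <=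
      \sum_(i < k) d / ((C + 1) * k.+1%:R).
    by apply: ler_sum => i _; exact/ltW/hw.
  rewrite sumr_const card_ord => h.
  have C1 : 0 < C + 1 by lra.
  apply: le_trans (ler_wpM2l C0 h) _.
  rewrite -[_ *+ k]mulr_natr mulrCA -[leRHS]mulr1 -mulrA ler_pM2l //.
  rewrite mulrC ler_pdivrMr // mul1r.
  by apply: ler_pM => //; rewrite ?lerDl // ler_nat.
have ldom : l \in seqdom.
  have [A FA hA] := cF 1 ltr01; have [v Av] := filter_ex FA.
  apply/seqdomP; exists (1 + rnorm v) => m.
  have -> : l = - (coords v - l) + coords v by rewrite opprB subrK.
  apply: le_trans (snD _ _ _ _) _; rewrite snN lerD ?sn_le_rnorm //.
  exact: key hA _ _ Av.
apply/cvg_ex; exists (SeqSpace ldom); apply/(cvg_rnorm sc) => e e0.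
have e2 : 0 < e / 2 by lra.
have [A FA hA] := cF _ e2.
apply: (filterS _ FA) => v Av; rewrite rnormBC.
apply: le_lt_trans (_ : e / 2 < e); last by lra.
by apply: rnorm_le_sn => m; exact: key FA hA _ _ Av.
Qed.

HB.instance Definition _ := Uniform_isComplete.Build seqspace seqspace_complete.

Lemma seqspaceD (v w : seqspace) i : coords (v + w) i = coords v i + coords w i.
Proof. by []. Qed.

Lemma seqspaceB (v w : seqspace) : coords (v - w) = coords v - coords w.
Proof. by []. Qed.

Lemma seqspaceZ c (v : seqspace) i : coords (c *: v) i = c * coords v i.
Proof. by []. Qed.

End SequenceSpace.

(** Minkowski's inequality, from the termwise bound with weights [1 + t] and [1 + t^-1] on the two
    squares. The optimal choice is [t = B / A]; if [A] or [B] is 0, one sum vanishes and [t] or its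
    inverse is taken arbitrarily small. *)
Lemma l2_add (R : realType) (I : Type) (r : seq I) (P : pred I) (u v : I -> R)
    (A B : R) : 0 <= A -> 0 <= B ->
  \sum_(i <- r | P i) u i ^+ 2 <= A ^+ 2 ->
  \sum_(i <- r | P i) v i ^+ 2 <= B ^+ 2 ->
  \sum_(i <- r | P i) (u i + v i) ^+ 2 <= (A + B) ^+ 2.
Proof.
move=> A0 B0 hu hv; set U := \sum_(i <- r | P i) u i ^+ 2 in hu *.
set V := \sum_(i <- r | P i) v i ^+ 2 in hv *.
have key t : 0 < t ->
    \sum_(i <- r | P i) (u i + v i) ^+ 2 <= (1 + t) * U + (1 + t^-1) * V.
  move=> t0; rewrite !mulr_sumr -big_split; apply: ler_sum => i _ /=.
  have t1 : t * t^-1 = 1 by rewrite mulfV // gt_eqF.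
  have s0 : 0 < t^-1 by rewrite invr_gt0.
  rewrite -subr_ge0.
  rewrite (_ : _ - _ = t^-1 * (t * u i - v i) ^+ 2); last first.
    by rewrite -[t in LHS]mulr1 -t1; field; rewrite gt_eqF.
  by apply: mulr_ge0; [exact: ltW|exact: sqr_ge0].
have U0 : 0 <= U by apply: sumr_ge0 => i _; exact: sqr_ge0.
have V0 : 0 <= V by apply: sumr_ge0 => i _; exact: sqr_ge0.
have [An|An] := eqVneq A 0; last first.
  have [Bn|Bn] := eqVneq B 0; last first.
    have Ap : 0 < A by rewrite lt_def An.
    have Bp : 0 < B by rewrite lt_def Bn.
    have t0 := divr_gt0 Bp Ap.
    apply: le_trans (key _ t0) _; rewrite invf_div.
    apply: le_trans (_ : (1 + B / A) * A ^+ 2 + (1 + A / B) * B ^+ 2 <= _).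
      by apply: lerD; apply: ler_wpM2l => //; rewrite addr_ge0 // divr_ge0.
    by rewrite le_eqVlt; apply/orP; left; apply/eqP; field; rewrite An Bn.
  have V00 : V = 0 by apply/eqP; rewrite eq_le V0 andbT; move: hv; rewrite Bn expr0n.
  rewrite Bn addr0; apply/ler_addgt0Pl => e e0.
  have t0 : 0 < e / (A ^+ 2 + 1) by rewrite divr_gt0 //; nra.
  apply: le_trans (key _ t0) _; rewrite V00 mulr0 addr0 mulrDl mul1r addrC lerD //.
  rewrite mulrAC ler_pdivrMr; last by nra.
  by rewrite ler_wpM2l // ?ltW //; lra.
have U00 : U = 0 by apply/eqP; rewrite eq_le U0 andbT; move: hu; rewrite An expr0n.
rewrite An add0r; apply/ler_addgt0Pl => e e0.
have t0 : 0 < e / (B ^+ 2 + 1) by rewrite divr_gt0 //; nra.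
have t0' : 0 < (e / (B ^+ 2 + 1))^-1 by rewrite invr_gt0.
apply: le_trans (key _ t0') _; rewrite U00 mulr0 add0r invrK mulrDl mul1r addrC lerD //.
rewrite mulrAC ler_pdivrMr; last by nra.
by rewrite ler_wpM2l // ?ltW //; lra.
Qed.

(** * Stability properties of seminorms *)

Section Seminorms.
Context {R : realType} {K : numFieldType} (sc : real_part R K).
Local Notation rnorm := (rnorm sc).
Context {E : lmodType K}.
Implicit Types q : E -> R.

Definition seminorm q := (forall a b, q (a + b) <= q a + q b) /\
  (forall c a, q (c *: a) <= rnorm c * q a).

Lemma seminorm_eq0 q : seminorm q -> q 0 = 0.
Proof.
case=> qD qZ; apply/eqP; rewrite eq_le; apply/andP; split.
  by have := qZ 0 0; rewrite scale0r rnorm0 mul0r.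
by have := qD 0 0; rewrite addr0; lra.
Qed.

Lemma seminormN q a : seminorm q -> q (- a) <= q a.
Proof. by case=> _ /(_ (-1) a); rewrite scaleN1r rnormN rnorm1 mul1r. Qed.

Lemma seminorm_ge0 q a : seminorm q -> 0 <= q a.
Proof.
move=> sq; have [qD _] := sq; have := qD a (- a); rewrite subrr seminorm_eq0 //.
by have := seminormN a sq; lra.
Qed.

Lemma seminormB q a b : seminorm q -> q (a - b) <= q a + q b.
Proof. by move=> sq; have := sq.1 a (- b); have := seminormN b sq; lra. Qed.

Lemma seminormZ q c a : seminorm q -> q (c *: a) = rnorm c * q a.
Proof.
move=> sq; apply/eqP; rewrite eq_le sq.2 /=; have [->|c0] := eqVneq c 0.
  by rewrite rnorm0 mul0r scale0r seminorm_eq0.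
have cV : rnorm c * rnorm c^-1 = 1 by rewrite -rnormM mulfV // rnorm1.
have := ler_wpM2l (rnorm_ge0 sc c) (sq.2 c^-1 (c *: a)).
by rewrite scalerA mulVf // scale1r mulrA cV mul1r.
Qed.

Lemma seminormD q1 q2 : seminorm q1 -> seminorm q2 ->
  seminorm (fun a => q1 a + q2 a).
Proof.
move=> [D1 Z1] [D2 Z2]; split=> [a b|c a].
  by have := D1 a b; have := D2 a b; lra.
by have := Z1 c a; have := Z2 c a; lra.
Qed.

Lemma seminorm_weight r q : 0 <= r -> seminorm q -> seminorm (fun a => r * q a).
Proof.
move=> r0 [D Z]; split=> [a b|c a]; first by rewrite -mulrDr ler_wpM2l.
by rewrite mulrCA ler_wpM2l.
Qed.

Lemma seminorm_sum (I : Type) (r : seq I) (q : I -> E -> R) :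
  (forall i, seminorm (q i)) -> seminorm (fun a => \sum_(i <- r) q i a).
Proof.
move=> sq; split=> [a b|c a].
  by rewrite -big_split ler_sum // => i _; apply: (sq i).1.
by rewrite mulr_sumr ler_sum // => i _; apply: (sq i).2.
Qed.

Lemma seminorm_max q1 q2 : seminorm q1 -> seminorm q2 ->
  seminorm (fun a => Num.max (q1 a) (q2 a)).
Proof.
move=> [D1 Z1] [D2 Z2]; split=> [a b|c a]; rewrite ge_max; apply/andP; split.
- by apply: le_trans (D1 _ _) (lerD _ _); rewrite le_max lexx.
- by apply: le_trans (D2 _ _) (lerD _ _); rewrite le_max lexx orbT.
- by apply: le_trans (Z1 _ _) _; rewrite ler_wpM2l ?rnorm_ge0 // le_max lexx.
- by apply: le_trans (Z2 _ _) _; rewrite ler_wpM2l ?rnorm_ge0 // le_max lexx orbT.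
Qed.

Lemma seminorm_bigmax (I : Type) (r : seq I) (q : I -> E -> R) :
  (forall i, seminorm (q i)) -> seminorm (fun a => \big[Num.max/0]_(i <- r) q i a).
Proof.
move=> sq; elim: r => [|i r IH].
  by split=> [a b|c a]; rewrite !big_nil ?addr0 ?mulr0.
have := seminorm_max (sq i) IH; congr seminorm; apply/funext => a.
by rewrite big_cons.
Qed.

Lemma seminorm_l2 m (q : nat -> E -> R) : (forall l, seminorm (q l)) ->
  seminorm (fun a => Num.sqrt (\sum_(0 <= n < m) q n a ^+ 2)).
Proof.
have s0 a n k (q' : nat -> E -> R) : 0 <= \sum_(n <= i < k) q' i a ^+ 2.
  by apply: sumr_ge0 => i _; exact: sqr_ge0.
move=> sq; split=> [a b|c a].
  rewrite -[leRHS]ger0_norm ?addr_ge0 ?sqrtr_ge0 // -sqrtr_sqr ler_sqrt ?sqr_ge0 //.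
  apply: le_trans (_ : \sum_(0 <= n < m) (q n a + q n b) ^+ 2 <= _).
    apply: ler_sum => n _; rewrite ler_sqr ?nnegrE ?addr_ge0 ?seminorm_ge0 //.
    exact: (sq n).1.
  by apply: l2_add; rewrite ?sqrtr_ge0 // sqr_sqrtr.
rewrite -[rnorm c]ger0_norm ?rnorm_ge0 // -sqrtr_sqr -sqrtrM ?sqr_ge0 //.
apply: ler_wsqrtr; rewrite mulr_sumr; apply: ler_sum => n _.
by rewrite -exprMn (seminormZ _ _ (sq n)).
Qed.

End Seminorms.

(** * The interpolation norm *)

Section FactorizationNorm.
Context {R : realType} {K : numFieldType} (sc : real_part R K).
Local Notation ofR := (ofR sc).
Local Notation rl := (rl sc).
Local Notation rnorm := (rnorm sc).
Local Notation seminorm := (seminorm sc).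
Context {F : normedModType K} (x : nat -> F).
Hypothesis x1 : forall k, rnorm (x k) = 1.
Implicit Types (a b : nat -> K) (n m k l : nat).

Definition part l a : F := \sum_(0 <= i < l) a i *: x i.

Definition truncate k a : nat -> K := fun i => if (i < k)%N then a i else 0.

Definition ell1 m a : R := \sum_(0 <= i < m) rnorm (a i).

Definition maxpart m a : R := \big[Num.max/0]_(0 <= l < m.+1) rnorm (part l a).

(* The K-functional of the pair (l1, partial sums) at scale [4 ^ n], computed on
   the first [m] coordinates. *)
Definition mix n m a : R :=
  inf [set (2^-1) ^+ n * ell1 m b + 2 ^+ n * maxpart m (a - b) | b in setT].

(** One index [m] cuts both the coordinates and the scales, so that [euc m] increases with [m] and
    involves only finitely many coordinates. *)
Definition euc m a : R := Num.sqrt (\sum_(0 <= n < m) mix n m a ^+ 2).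

Definition damp l a : R := \sum_(0 <= i < l) (2^-1) ^+ i * rnorm (a i).

(* The second term dominates the norm of the image strictly, but only by
   [2 ^ - i] on the unit vector [i]. *)
Definition fnorm m a : R := Num.max (2^-1 * euc m a)
  (\big[Num.max/0]_(0 <= l < m.+1) (rnorm (part l a) + damp l a)).

Lemma part_lin l : linear (part l).
Proof.
move=> c a b; rewrite /part scaler_sumr -big_split; apply: eq_bigr => i _ /=.
by rewrite scalerA -scalerDl.
Qed.

Lemma part0 a : part 0 a = 0.
Proof. by rewrite /part big_geq. Qed.

Lemma ell10 a : ell1 0 a = 0.
Proof. by rewrite /ell1 big_geq. Qed.

Lemma seminorm_part l : seminorm (fun a => rnorm (part l a)).
Proof.
split=> [a b|c a]; first by rewrite (linD (part_lin l)) rnormD.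
by rewrite (linZ (part_lin l)) rnormZ.
Qed.

Lemma seminorm_coord i : seminorm (fun a => rnorm (a i)).
Proof. by split=> [a b|c a]; [exact: rnormD|rewrite -rnormM]. Qed.

Lemma seminorm_ell1 m : seminorm (ell1 m).
Proof. by apply: seminorm_sum => i; exact: seminorm_coord. Qed.

Lemma seminorm_maxpart m : seminorm (maxpart m).
Proof. by apply: seminorm_bigmax => l; exact: seminorm_part. Qed.

Lemma seminorm_damp l : seminorm (damp l).
Proof.
apply: seminorm_sum => i; apply: seminorm_weight; last exact: seminorm_coord.
by rewrite exprn_ge0.
Qed.

Lemma part_le_maxpart l m a : (l <= m)%N -> rnorm (part l a) <= maxpart m a.
Proof.
move=> lm; apply: (@le_bigmax_seq _ _ _ _ _ l xpredT (fun l => rnorm (part l a))) => //.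
by rewrite mem_index_iota.
Qed.

Lemma maxpart_le m a (C : R) : 0 <= C ->
  (forall l, (l <= m)%N -> rnorm (part l a) <= C) -> maxpart m a <= C.
Proof.
move=> C0 hC; rewrite /maxpart big_seq.
apply: (big_ind (fun z => z <= C)) => // [u v hu hv|l].
  by rewrite ge_max hu hv.
by rewrite mem_index_iota /= ltnS => /hC.
Qed.

Lemma ell1_ge0 m a : 0 <= ell1 m a.
Proof. exact: seminorm_ge0 (seminorm_ell1 m). Qed.

Lemma maxpart_ge0 m a : 0 <= maxpart m a.
Proof. exact: seminorm_ge0 (seminorm_maxpart m). Qed.

Lemma ell1_mono l m a : (l <= m)%N -> ell1 l a <= ell1 m a.
Proof.
move=> lm; rewrite /ell1 (@big_cat_nat _ _ _ l 0 m) //= lerDl.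
by apply: sumr_ge0 => i _; exact: rnorm_ge0.
Qed.

Lemma maxpart_mono l m a : (l <= m)%N -> maxpart l a <= maxpart m a.
Proof.
move=> lm; apply: maxpart_le; first exact: maxpart_ge0.
by move=> k kl; apply: part_le_maxpart; exact: leq_trans kl lm.
Qed.

Lemma part_diff k l a : (k <= l)%N ->
  rnorm (part l a - part k a) <= ell1 l a - ell1 k a.
Proof.
move=> kl; rewrite /part /ell1 !(@big_cat_nat _ _ _ k 0 l) //=.
rewrite [X in X <= _](_ : _ = rnorm (\sum_(k <= i < l) a i *: x i)); last first.
  by rewrite addrAC subrr add0r.
rewrite [leRHS]addrAC subrr add0r; apply: le_trans (rnorm_sum _ _ _ _) _.
by apply: ler_sum => i _; rewrite rnormZ x1 mulr1.
Qed.

Lemma part_le_ell1 l a : rnorm (part l a) <= ell1 l a.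
Proof.
by have := part_diff a (leq0n l); rewrite part0 ell10 !subr0.
Qed.

Lemma maxpart_le_ell1 m a : maxpart m a <= ell1 m a.
Proof.
apply: maxpart_le => [|l lm]; first exact: ell1_ge0.
exact: le_trans (part_le_ell1 _ _) (ell1_mono _ lm).
Qed.

Lemma part_trunc l k a : part l (truncate k a) = part (minn l k) a.
Proof.
rewrite /part /truncate; have [lk|kl] := leqP l k.
  by apply: eq_big_nat => i /andP[_ il]; rewrite (leq_trans il lk).
rewrite (@big_cat_nat _ _ _ k 0 l) ?(ltnW kl) //= [X in _ + X]big_nat_cond.
rewrite [X in _ + X]big1 ?addr0; last first.
  by move=> i /andP[/andP[ki _] _]; rewrite ltnNge ki scale0r.
by apply: eq_big_nat => i /andP[_ ->].
Qed.

Lemma ell1_trunc m k a : ell1 m (truncate k a) <= ell1 m a.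
Proof.
apply: ler_sum => i _; rewrite /truncate; case: ifP => // _.
by rewrite rnorm0 rnorm_ge0.
Qed.

Lemma maxpart_trunc m k a : maxpart m (truncate k a) <= maxpart m a.
Proof.
apply: maxpart_le => [|l lm]; first exact: maxpart_ge0.
by rewrite part_trunc part_le_maxpart // geq_min lm.
Qed.

Lemma truncateD k a b : truncate k (a + b) = truncate k a + truncate k b.
Proof.
apply/funext => i; transitivity (truncate k a i + truncate k b i) => //.
by rewrite /truncate; case: ifP => // _; rewrite addr0.
Qed.

Lemma truncateZ k c a : truncate k (c *: a) = c *: truncate k a.
Proof.
apply/funext => i; transitivity (c * truncate k a i) => //.
by rewrite /truncate; case: ifP => // _; rewrite mulr0.
Qed.

Lemma truncateB k a b : truncate k (a - b) = truncate k a - truncate k b.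
Proof. by rewrite truncateD -scaleN1r truncateZ scaleN1r. Qed.

Let mixset n m a :=
  [set (2^-1) ^+ n * ell1 m b + 2 ^+ n * maxpart m (a - b) | b in setT].

Lemma pow_half_gt0 n : 0 < (2^-1) ^+ n :> R.
Proof. by rewrite exprn_gt0. Qed.

Lemma pow_two_gt0 n : 0 < 2 ^+ n :> R.
Proof. by rewrite exprn_gt0. Qed.

Lemma mix_has_inf n m a : has_inf (mixset n m a).
Proof.
split; first by exists ((2^-1) ^+ n * ell1 m 0 + 2 ^+ n * maxpart m (a - 0)), 0.
by exists 0 => _ [b _ <-]; rewrite addr_ge0 // mulr_ge0 ?ell1_ge0 ?maxpart_ge0 //.
Qed.

Lemma mix_le n m a b : mix n m a <= (2^-1) ^+ n * ell1 m b + 2 ^+ n * maxpart m (a - b).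
Proof. by apply: ge_inf; [case: (mix_has_inf n m a)|exists b]. Qed.

Lemma le_mix n m a (C : R) :
  (forall b, C <= (2^-1) ^+ n * ell1 m b + 2 ^+ n * maxpart m (a - b)) ->
  C <= mix n m a.
Proof.
by move=> h; apply: lb_le_inf; [case: (mix_has_inf n m a)|move=> _ [b _ <-]].
Qed.

Lemma mix_split n m a (C : R) : mix n m a < C -> exists b,
  ell1 m b < 2 ^+ n * C /\ maxpart m (a - b) < (2^-1) ^+ n * C.
Proof.
move=> hC; have [_ [b _ <-] hb] := inf_lt (mix_has_inf n m a).1 hC.
exists b; have h0 := pow_half_gt0 n; have t0 := pow_two_gt0 n.
have e0 := ell1_ge0 m b; have m0 := maxpart_ge0 m (a - b).
have p1 := mulr_ge0 (ltW h0) e0.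
have p2 := mulr_ge0 (ltW t0) m0.
split; first by rewrite -ltr_pdivrMl // -exprVn; lra.
by rewrite -ltr_pdivrMl // exprVn invrK; lra.
Qed.

Lemma seminorm_mix n m : seminorm (mix n m).
Proof.
have [h0 t0] := (ltW (pow_half_gt0 n), ltW (pow_two_gt0 n)).
have [eD eZ] := seminorm_ell1 m; have [mD mZ] := seminorm_maxpart m.
split=> [a b|c a].
  rewrite -lerBlDl; apply: le_mix => b'; rewrite lerBlDl -lerBlDr.
  apply: le_mix => a'; rewrite lerBlDr.
  apply: le_trans (mix_le n m (a + b) (a' + b')) _.
  rewrite (_ : a + b - (a' + b') = (a - a') + (b - b')); last first.
    by rewrite opprD addrACA.
  have := ler_wpM2l h0 (eD a' b'); have := ler_wpM2l t0 (mD (a - a') (b - b')).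
  by rewrite !mulrDr; lra.
have [->|c0] := eqVneq c 0.
  rewrite rnorm0 mul0r scale0r; apply: le_trans (mix_le n m 0 0) _.
  rewrite subr0 (seminorm_eq0 (seminorm_ell1 m)).
  by rewrite (seminorm_eq0 (seminorm_maxpart m)) !mulr0 addr0.
have cp : 0 < rnorm c.
  by rewrite lt_def rnorm_ge0 andbT; apply/eqP => /rnorm_eq0/eqP; rewrite (negPf c0).
rewrite -ler_pdivrMl //; apply: le_mix => b; rewrite ler_pdivrMl //.
apply: le_trans (mix_le n m (c *: a) (c *: b)) _.
rewrite -scalerBr (seminormZ _ _ (seminorm_ell1 m)) (seminormZ _ _ (seminorm_maxpart m)).
by rewrite mulrDr ![rnorm c * (_ ^+ n * _)]mulrCA.
Qed.

Lemma mix_ge0 n m a : 0 <= mix n m a.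
Proof. exact: seminorm_ge0 (seminorm_mix n m). Qed.

Lemma mix_le_maxpart n m a : mix n m a <= 2 ^+ n * maxpart m a.
Proof.
by have := mix_le n m a 0; rewrite subr0 (seminorm_eq0 (seminorm_ell1 m)) mulr0 add0r.
Qed.

Lemma mix_le_ell1 n m a : mix n m a <= (2^-1) ^+ n * ell1 m a.
Proof.
by have := mix_le n m a a; rewrite subrr (seminorm_eq0 (seminorm_maxpart m)) mulr0 addr0.
Qed.

Lemma mix_mono n l m a : (l <= m)%N -> mix n l a <= mix n m a.
Proof.
move=> lm; apply: le_mix => b; apply: le_trans (mix_le n l a b) _.
by apply: lerD; rewrite ler_wpM2l ?ell1_mono ?maxpart_mono ?(ltW (pow_half_gt0 n)) ?(ltW (pow_two_gt0 n)).
Qed.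

(** A decomposition of [a] truncates to one of [truncate k a], and neither piece grows; this is the
    source of the monotonicity of the basis. *)
Lemma mix_trunc n m k a : mix n m (truncate k a) <= mix n m a.
Proof.
apply: le_mix => b; apply: le_trans (mix_le n m (truncate k a) (truncate k b)) _.
rewrite -truncateB.
by apply: lerD; rewrite ler_wpM2l ?ell1_trunc ?maxpart_trunc ?(ltW (pow_half_gt0 n)) ?(ltW (pow_two_gt0 n)).
Qed.

(** At scale 0 both weights are 1, and [maxpart] is at most [ell1] because the [x i] have norm one;
    so every decomposition costs at least [maxpart m a]. *)
Lemma maxpart_le_mix m a : maxpart m a <= mix 0 m a.
Proof.
apply: le_mix => b; rewrite !expr0 !mul1r.
have := (seminorm_maxpart m).1 b (a - b); rewrite addrC subrK.
by have := maxpart_le_ell1 m b; lra.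
Qed.

Lemma euc_sqr m a : euc m a ^+ 2 = \sum_(0 <= n < m) mix n m a ^+ 2.
Proof. by rewrite sqr_sqrtr //; apply: sumr_ge0 => i _; exact: sqr_ge0. Qed.

Lemma euc_le m a (C : R) : 0 <= C ->
  \sum_(0 <= n < m) mix n m a ^+ 2 <= C ^+ 2 -> euc m a <= C.
Proof.
by move=> C0 h; rewrite -ler_sqr ?nnegrE ?sqrtr_ge0 // euc_sqr.
Qed.

Lemma mix_le_euc n m a : (n < m)%N -> mix n m a <= euc m a.
Proof.
move=> nm; rewrite -ler_sqr ?nnegrE ?sqrtr_ge0 ?mix_ge0 // euc_sqr.
rewrite (@big_cat_nat _ _ _ n 0 m) ?(ltnW nm) //= [X in _ + X]big_ltn // addrCA lerDl.
by rewrite addr_ge0 //; apply: sumr_ge0 => i _; exact: sqr_ge0.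
Qed.

Lemma seminorm_euc m : seminorm (euc m).
Proof. by apply: seminorm_l2 => n; exact: seminorm_mix. Qed.

Lemma euc_ge0 m a : 0 <= euc m a.
Proof. exact: sqrtr_ge0. Qed.

Lemma euc_mono l m a : (l <= m)%N -> euc l a <= euc m a.
Proof.
move=> lm; apply: euc_le; rewrite ?euc_ge0 // euc_sqr.
rewrite [leRHS](@big_cat_nat _ _ _ l 0 m) //=.
apply: le_trans (_ : \sum_(0 <= n < l) mix n m a ^+ 2 <= _).
  apply: ler_sum => n _; rewrite ler_sqr ?nnegrE ?mix_ge0 //; exact: mix_mono.
by rewrite lerDl; apply: sumr_ge0 => i _; exact: sqr_ge0.
Qed.

Lemma maxpart_le_euc m a : maxpart m a <= euc m a.
Proof.
case: m => [|m].
  apply: maxpart_le; rewrite ?euc_ge0 // => l; rewrite leqn0 => /eqP ->.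
  by rewrite part0 rnorm0 euc_ge0.
exact: le_trans (maxpart_le_mix _ _) (mix_le_euc _ _).
Qed.

Lemma coord_le_maxpart i m a : (i < m)%N -> rnorm (a i) <= 2 * maxpart m a.
Proof.
move=> im; have -> : rnorm (a i) = rnorm (part i.+1 a - part i a).
  by rewrite /part big_nat_recr //= addrAC subrr add0r rnormZ x1 mulr1.
apply: le_trans (rnormB _ _ _) _.
by have := part_le_maxpart a im; have := part_le_maxpart a (ltnW im); lra.
Qed.

Lemma geometric_le2 l : \sum_(0 <= i < l) (2^-1) ^+ i <= 2 - (2^-1) ^+ l *+ 2 :> R.
Proof.
elim: l => [|l IH]; first by rewrite big_geq // expr0 subrr.
by rewrite big_nat_recr //= exprS; move: IH; set u := (2^-1) ^+ l; lra.
Qed.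

(** A coordinate is the norm of a difference of two partial sums, hence at most [2 * maxpart m a],
    and the weights sum to less than 2. *)
Lemma damp_le_maxpart l m a : (l <= m)%N -> damp l a <= 4 * maxpart m a.
Proof.
move=> lm; apply: le_trans (_ : \sum_(0 <= i < l) (2^-1) ^+ i * (2 * maxpart m a) <= _).
  rewrite /damp big_seq [leRHS]big_seq; apply: ler_sum => i.
  rewrite mem_index_iota => /andP[_ il].
  by rewrite ler_wpM2l ?(ltW (pow_half_gt0 i)) // coord_le_maxpart // (leq_trans il lm).
rewrite -mulr_suml; have := geometric_le2 l; have := pow_half_gt0 l.
by have := maxpart_ge0 m a; nra.
Qed.

Lemma fnorm_le_euc m a : fnorm m a <= 5 * euc m a.
Proof.
have h := euc_ge0 m a; rewrite /fnorm ge_max; apply/andP; split; first by lra.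
rewrite big_seq; apply: (big_ind (fun z => z <= _)) => [|u v hu hv|l].
- by lra.
- by rewrite ge_max hu hv.
rewrite mem_index_iota /= ltnS => lm.
have := part_le_maxpart a lm; have := damp_le_maxpart a lm.
by have := maxpart_le_euc m a; lra.
Qed.

Lemma euc_le_fnorm m a : euc m a <= 2 * fnorm m a.
Proof.
have : 2^-1 * euc m a <= fnorm m a by rewrite /fnorm le_max lexx.
by lra.
Qed.

Lemma damped_le_fnorm l m a : (l <= m)%N ->
  rnorm (part l a) + damp l a <= fnorm m a.
Proof.
move=> lm; rewrite /fnorm le_max; apply/orP; right.
apply: (@le_bigmax_seq _ _ _ _ _ l xpredT (fun l => rnorm (part l a) + damp l a)) => //.
by rewrite mem_index_iota.
Qed.

Lemma seminorm_fnorm m : seminorm (fnorm m).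
Proof.
apply: seminorm_max.
  by apply: seminorm_weight; [lra|exact: seminorm_euc].
apply: seminorm_bigmax => l.
by apply: seminormD; [exact: seminorm_part|exact: seminorm_damp].
Qed.

Lemma fnorm_trunc m k a : fnorm m (truncate k a) <= fnorm m a.
Proof.
rewrite {1}/fnorm ge_max; apply/andP; split.
  rewrite /fnorm le_max; apply/orP; left; rewrite ler_wpM2l //.
  apply: euc_le; rewrite ?euc_ge0 // euc_sqr; apply: ler_sum => n _.
  by rewrite ler_sqr ?nnegrE ?mix_ge0 ?mix_trunc.
rewrite big_seq; apply: (big_ind (fun z => z <= _)) => [|u v hu hv|l].
- exact: seminorm_ge0 (seminorm_fnorm m).
- by rewrite ge_max hu hv.
rewrite mem_index_iota /= ltnS => lm; rewrite part_trunc.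
apply: le_trans (damped_le_fnorm a (_ : minn l k <= m)%N); last first.
  by rewrite geq_min lm.
rewrite lerD2l /damp /truncate; have [lk|kl] := leqP l k.
  rewrite !big_seq; apply: ler_sum => i; rewrite mem_index_iota => /andP[_ il].
  by rewrite (leq_trans il lk).
rewrite (@big_cat_nat _ _ _ k 0 l) ?(ltnW kl) //= [X in _ + X]big_nat_cond.
rewrite [X in _ + X]big1 ?addr0; last first.
  by move=> i /andP[/andP[ki _] _]; rewrite ltnNge ki rnorm0 mulr0.
rewrite !big_seq; apply: ler_sum => i; rewrite mem_index_iota => /andP[_ ik].
by rewrite ik.
Qed.

Lemma fnorm_le_coord m : exists (C : R) k, 0 <= C /\
  forall a, fnorm m a <= C * \sum_(i < k) rnorm (a i).
Proof.
exists (5 * m%:R), m; split=> [|a]; first by rewrite mulr_ge0.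
apply: le_trans (fnorm_le_euc _ _) _.
rewrite -(big_mkord xpredT (fun i => rnorm (a i))) -/(ell1 m a).
have e0 := ell1_ge0 m a.
rewrite -mulrA ler_wpM2l //; apply: euc_le; first by rewrite mulr_ge0.
apply: le_trans (_ : \sum_(0 <= n < m) ell1 m a ^+ 2 <= _).
  apply: ler_sum => n _; rewrite ler_sqr ?nnegrE ?mix_ge0 //.
  apply: le_trans (mix_le_ell1 n m a) _; rewrite -[leRHS]mul1r ler_wpM2r //.
  by apply: exprn_ile1 => //; lra.
rewrite sumr_const_nat subn0 exprMn -[_ *+ m]mulr_natl ler_wpM2r ?sqr_ge0 //.
by rewrite -natrX ler_nat -mulnn; case: (m) => // k; rewrite leq_pmulr.
Qed.

Lemma coord_le_fnorm i : exists m (C : R), 0 <= C /\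
  forall a, rnorm (a i) <= C * fnorm m a.
Proof.
exists i.+1, 4; split=> // a; have := coord_le_maxpart a (ltnSn i).
by have := maxpart_le_euc i.+1 a; have := euc_le_fnorm i.+1 a; lra.
Qed.

Definition factor_seqnorm : seqnorm sc := SeqNorm
  (fun m => (seminorm_fnorm m).1) (fun m c a => seminormZ c a (seminorm_fnorm m))
  fnorm_le_coord coord_le_fnorm.

End FactorizationNorm.

(** * Tail estimates and convergence of truncations *)

Section FactorizationTails.
Context {R : realType} {K : numFieldType} (sc : real_part R K).
Local Notation ofR := (ofR sc).
Local Notation rl := (rl sc).
Local Notation rnorm := (rnorm sc).
Context {F : normedModType K} (x : nat -> F).
Hypothesis x1 : forall k, rnorm (x k) = 1.
Implicit Types (a b : nat -> K) (n m k l : nat).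
Local Notation part := (part x).
Local Notation ell1 := (ell1 sc).
Local Notation maxpart := (maxpart sc x).
Local Notation mix := (mix sc x).
Local Notation euc := (euc sc x).
Local Notation fnorm := (fnorm sc x).

Lemma half_small (e : R) : 0 < e -> exists n, (2^-1) ^+ n < e.
Proof.
move=> e0; have [N _ hN] := near_infty_natSinv_expn_lt (PosNum e0).
exists N; have := hN N (leqnn N); by rewrite /= div1r exprVn.
Qed.

Lemma archi_lt (C e : R) : 0 < e -> exists r : nat, C < r%:R * e.
Proof.
move=> e0; have [r hr] : exists r : nat, C / e < r%:R.
  exists (Num.bound `|C / e|).
  by apply: le_lt_trans (ler_norm _) _; apply: archi_boundP.
by exists r; rewrite -ltr_pdivrMr.
Qed.

(* If the partial sums oscillated by [e] on [r] disjoint blocks, every splitting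
   [a = b + (a - b)] with [a - b] uniformly small would give [b] an l1-norm of
   order [r e]. *)
Lemma part_cauchy a (C : R) : (forall m, euc m a <= C) -> forall e : R, 0 < e ->
  exists k0, forall k l, (k0 <= k)%N -> (k <= l)%N ->
    rnorm (part l a - part k a) <= e.
Proof.
move=> hC e e0; apply: contrapT => /forallNP hosc.
have C0 : 0 <= C := le_trans (euc_ge0 sc x 0 a) (hC 0%N).
have claim (r : nat) : exists m, forall b, maxpart m (a - b) <= e / 4 ->
    r%:R * (e / 2) <= ell1 m b.
  elim: r => [|r [m IH]]; first by exists 0%N => b _; rewrite mul0r ell1_ge0.
  have [k [l [mk [kl hkl]]]] : exists k l, (m <= k)%N /\ (k <= l)%N /\
      e < rnorm (part l a - part k a).
    apply: contrapT => h; apply: (hosc m) => k l mk kl; rewrite leNgt.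
    by apply/negP => hlt; apply: h; exists k, l.
  exists l => b hb.
  have hm : maxpart m (a - b) <= e / 4.
    by apply: le_trans hb; apply: maxpart_mono; exact: leq_trans mk kl.
  have h1 := le_trans (part_le_maxpart sc x (a - b) (leqnn l)) hb.
  have h2 := le_trans (part_le_maxpart sc x (a - b) kl) hb.
  have h3 := part_diff x1 b kl.
  have h4 := le_trans (IH b hm) (ell1_mono sc b mk).
  (* Replacing [a] by [b] costs at most [e / 4] at each end of the block, so [b] keeps an
     oscillation of at least [e / 2] there. *)
  have : rnorm (part l a - part k a) <= rnorm (part l (a - b)) +
      rnorm (part k (a - b)) + rnorm (part l b - part k b).
    have e1 i : part i a = part i (a - b) + part i b.
      by rewrite -(linD (part_lin x _)) subrK.
    rewrite (e1 l) (e1 k) opprD addrACA.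
    by apply: le_trans (rnormD _ _ _) _; rewrite lerD2r; exact: rnormB.
  rewrite -natr1 mulrDl mul1r; lra.
have [n hn] : exists n, (2^-1) ^+ n < e / 4 / (C + 1).
  by apply: half_small; rewrite !divr_gt0 //; lra.
have e2 : 0 < e / 2 by lra.
have [r hr] := archi_lt (2 ^+ n * (C + 1)) e2; have [m hm] := claim r.
(* Scale [n] makes [maxpart] of [a - b] smaller than [e / 4] while [ell1] of [b] stays below
   [2 ^+ n * (C + 1)], which [r] was chosen to exceed. Taking at least [n.+1] coordinates makes
   scale [n] occur in [euc]. *)
have [|b [b1 b2]] := @mix_split R K sc F x n (maxn m n.+1) a (C + 1).
  apply: le_lt_trans (_ : C < _); last by lra.
  by apply: le_trans (hC (maxn m n.+1)); apply: mix_le_euc; rewrite leq_max ltnSn orbT.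
have := hm b; have := ell1_mono sc b (leq_maxl m n.+1).
have := maxpart_mono sc x (a - b) (leq_maxl m n.+1).
move: hn; rewrite ltr_pdivlMr; last by lra.
move=> h1 h2 h3 h4; have := h4 ltac:(lra); lra.
Qed.

(** The bound must hold for all [m] although [mix n m a] grows with [m]. With [euc M a ^+ 2] within
    [e] of its supremum, monotonicity shows that the first [M] scales already carry that much for
    every larger [m]. *)
Lemma mix_tail a (C e : R) : (forall m, euc m a <= C) -> 0 < e ->
  exists M, forall m, \sum_(M <= n < m) mix n m a ^+ 2 <= e.
Proof.
move=> hC e0; have C0 : 0 <= C := le_trans (euc_ge0 sc x 0 a) (hC 0%N).
pose A := [set euc m a ^+ 2 | m in setT].
have hA : has_sup A.
  split; first by exists (euc 0 a ^+ 2), 0%N.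
  exists (C ^+ 2) => _ [m _ <-]; rewrite ler_sqr ?nnegrE ?euc_ge0 //.
have [_ [M _ <-] hM] := sup_adherent e0 hA.
exists M => m; have [mM|Mm] := leqP m M; first by rewrite big_geq // ltW.
have : euc m a ^+ 2 <= sup A by apply: ub_le_sup; [case: hA|exists m].
rewrite euc_sqr (@big_cat_nat _ _ _ M 0 m) ?(ltnW Mm) //= => h.
have : euc M a ^+ 2 <= \sum_(0 <= i < M) mix i m a ^+ 2.
  rewrite euc_sqr; apply: ler_sum => n _.
  by rewrite ler_sqr ?nnegrE ?mix_ge0 // mix_mono // ltnW.
by move: h hM; rewrite /A; lra.
Qed.

Lemma mix_head m M a (d e : R) : 0 <= e -> maxpart m a <= d ->
  2 ^+ M * d * M%:R <= e -> \sum_(0 <= n < M) mix n m a ^+ 2 <= e ^+ 2.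
Proof.
move=> e0 hd hM; have m0 := maxpart_ge0 sc x m a.
have d0 : 0 <= d by exact: le_trans hd.
apply: le_trans (_ : \sum_(0 <= n < M) (2 ^+ M * d) ^+ 2 <= _).
  rewrite big_seq [leRHS]big_seq; apply: ler_sum => n.
  rewrite mem_index_iota => /andP[_ nM].
  rewrite ler_sqr ?nnegrE ?mix_ge0 ?mulr_ge0 //.
  apply: le_trans (mix_le_maxpart _ _ _ _ _) _; apply: ler_pM => //.
  by apply: ler_weXn2l; [lra|exact: ltnW].
rewrite sumr_const_nat subn0; apply: le_trans (_ : (2 ^+ M * d * M%:R) ^+ 2 <= _).
  rewrite [leRHS]exprMn -[_ *+ M]mulr_natr ler_wpM2l ?sqr_ge0 //.
  by rewrite -natrX ler_nat -mulnn; case: (M) => // k; rewrite leq_pmulr.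
by rewrite ler_sqr ?nnegrE ?mulr_ge0.
Qed.

Lemma sum_mix_split m M a : euc m a ^+ 2 <=
  \sum_(0 <= n < M) mix n m a ^+ 2 + \sum_(M <= n < m) mix n m a ^+ 2.
Proof.
rewrite euc_sqr; have [mM|Mm] := leqP m M.
  rewrite [X in _ + X]big_geq // addr0 [leRHS](@big_cat_nat _ _ _ m 0 M) //= lerDl.
  by apply: sumr_ge0 => i _; exact: sqr_ge0.
by rewrite (@big_cat_nat _ _ _ M 0 m) ?(ltnW Mm).
Qed.

(** The low scales of the remainder are small because its partial sums are, by [part_cauchy]; the
    high scales because passing to the remainder at most doubles each [mix], whose tail is small. *)
Lemma trunc_cvg a (C : R) : (forall m, euc m a <= C) -> forall e : R, 0 < e ->
  exists k0, forall k, (k0 <= k)%N -> forall m, fnorm m (a - truncate k a) <= e.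
Proof.
move=> hC e e0.
(* Doubling [mix] turns this tail into [(e / 10) ^+ 2], matching the head; then [euc] is at most
   [e / 5], and [fnorm] at most five times that. *)
have [|M hM] := @mix_tail a C ((e / 20) ^+ 2) hC; first by rewrite exprn_gt0 //; lra.
pose d := e / 10 / (2 ^+ M * M.+1%:R).
have D0 : 0 < 2 ^+ M * M.+1%:R :> R by rewrite mulr_gt0 // exprn_gt0.
have d0 : 0 < d by rewrite divr_gt0 //; lra.
have dM : 2 ^+ M * d * M%:R <= e / 10.
  rewrite (_ : 2 ^+ M * d * M%:R = e / 10 * (M%:R / M.+1%:R)).
    rewrite -[leRHS]mulr1 ler_wpM2l //; first by lra.
    by rewrite ler_pdivrMr // mul1r ler_nat.
  by rewrite /d; field; rewrite nat1r pnatr_eq0 /= expf_neq0.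
have [k0 hk0] := part_cauchy hC d0.
exists k0 => k kk m; apply: le_trans (fnorm_le_euc x1 _ _) _.
have mp : maxpart m (a - truncate k a) <= d.
  apply: maxpart_le => [|l lm]; first exact: ltW.
  rewrite (linB (part_lin x _)) part_trunc; have [lk|kl] := leqP l k.
    by rewrite subrr rnorm0 ltW.
  by apply: hk0 => //; exact: ltnW.
suff : euc m (a - truncate k a) <= e / 10 + e / 10 by lra.
apply: euc_le; first by lra.
rewrite -euc_sqr; apply: le_trans (sum_mix_split m M _) _.
have h1 : \sum_(0 <= n < M) mix n m (a - truncate k a) ^+ 2 <= (e / 10) ^+ 2.
  by apply: mix_head mp dM; lra.
have h2 : \sum_(M <= n < m) mix n m (a - truncate k a) ^+ 2 <= 4 * (e / 20) ^+ 2.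
  apply: le_trans (ler_wpM2l _ (hM m)) => //; rewrite mulr_sumr.
  apply: ler_sum => n _; rewrite (_ : 4 = 2 ^+ 2); last by ring.
  rewrite -exprMn ler_sqr ?nnegrE ?mulr_ge0 ?mix_ge0 //.
  apply: le_trans (seminormB _ _ (seminorm_mix sc x n m)) _.
  by have := mix_trunc sc x n m k a; lra.
by apply: le_trans (lerD h1 h2) _; nra.
Qed.

End FactorizationTails.

(** * The interpolation space *)

Section FactorizationSpace.
Context {R : realType} {K : numFieldType} (sc : real_part R K).
Local Notation ofR := (ofR sc).
Local Notation rl := (rl sc).
Local Notation rnorm := (rnorm sc).
Context {F : completeNormedModType K} (x : nat -> F).
Hypothesis x1 : forall k, rnorm (x k) = 1.
Implicit Types (a b : nat -> K) (n m k l : nat).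
Local Notation part := (part x).
Local Notation ell1 := (ell1 sc).
Local Notation maxpart := (maxpart sc x).
Local Notation mix := (mix sc x).
Local Notation euc := (euc sc x).
Local Notation fnorm := (fnorm sc x).
Local Notation G := (seqspace (factor_seqnorm x1)).
Implicit Types u v w : G.

Lemma fnorm_le_rnorm m v : fnorm m v <= rnorm v.
Proof. exact: (sn_le_rnorm (p := factor_seqnorm x1)). Qed.

Lemma rnorm_le_fnorm v (C : R) : (forall m, fnorm m v <= C) -> rnorm v <= C.
Proof. exact: (rnorm_le_sn (p := factor_seqnorm x1)). Qed.

Lemma euc_le_rnorm m v : euc m v <= 2 * rnorm v.
Proof. by have := euc_le_fnorm sc x m v; have := fnorm_le_rnorm m v; lra. Qed.

Lemma part_le_rnorm l v : rnorm (part l v) <= rnorm v.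
Proof.
apply: le_trans (fnorm_le_rnorm l v); apply: le_trans (damped_le_fnorm _ _ _ (leqnn l)).
by rewrite lerDl; exact: seminorm_ge0 (seminorm_damp sc l).
Qed.

Lemma coord_le_rnorm i v : rnorm (coords v i) <= 4 * rnorm v.
Proof.
have := coord_le_maxpart x1 v (ltnSn i).
by have := maxpart_le_euc x1 i.+1 v; have := euc_le_rnorm i.+1 v; lra.
Qed.

Definition unit_seq i : nat -> K := fun j => (j == i)%:R.

Lemma ell1_unit_seq i m : ell1 m (unit_seq i) <= 1.
Proof.
have [im|mi] := ltnP i m.
  rewrite /ell1 (@big_cat_nat _ _ _ i 0 m) ?(ltnW im) //= [X in _ + X]big_ltn //.
  rewrite {2}/unit_seq eqxx rnorm1 big_nat_cond big1 => [|j].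
    rewrite add0r big_nat_cond big1 ?addr0 // => j /andP[/andP[ij _] _].
    by rewrite /unit_seq gtn_eqF // rnorm0.
  by move=> /andP[/andP[_ ij] _]; rewrite /unit_seq ltn_eqF // rnorm0.
rewrite /ell1 big_nat_cond big1 ?ler01 // => j /andP[/andP[_ jm] _].
by rewrite /unit_seq ltn_eqF ?rnorm0 // (leq_trans jm).
Qed.

(** The trivial decomposition gives [mix n <= 2 ^ - n]. The factor [2^-1] in [fnorm] compensates the
    bound 2. *)
Lemma euc_unit_seq i m : euc m (unit_seq i) <= 2.
Proof.
apply: euc_le => //; apply: le_trans (_ : \sum_(0 <= n < m) (2^-1) ^+ n <= _).
  apply: ler_sum => n _.
  have h : mix n m (unit_seq i) <= (2^-1) ^+ n.
    apply: le_trans (mix_le_ell1 sc x n m _) _.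
    by rewrite -[leRHS]mulr1 ler_wpM2l ?ell1_unit_seq // exprn_ge0.
  apply: le_trans (_ : ((2^-1) ^+ n) ^+ 2 <= _).
    by rewrite ler_sqr ?nnegrE ?mix_ge0 ?exprn_ge0.
  rewrite expr2 -[leRHS]mulr1 ler_wpM2l ?exprn_ge0 //.
  by apply: exprn_ile1 => //; lra.
by have := @geometric_le2 R m; have := @pow_half_gt0 R m; lra.
Qed.

Lemma unit_seq_dom i : unit_seq i \in seqdom (factor_seqnorm x1).
Proof.
apply/seqdomP; exists 10 => m; apply: le_trans (fnorm_le_euc x1 _ _) _.
by have := euc_unit_seq i m; lra.
Qed.

Definition basis_vec i : G := SeqSpace (unit_seq_dom i).

(** Defined on arbitrary sequences, since it is applied to the coordinates of a bidual element
    before these are known to form a vector of [G]. *)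
Definition sproj k a : G := \sum_(0 <= i < k) a i *: basis_vec i.

Lemma coords_proj k a : coords (sproj k a) = truncate k a.
Proof.
apply/funext => j; rewrite /truncate; elim: k => [|k IH].
  by rewrite /sproj big_geq.
transitivity (coords (sproj k a) j + a k * unit_seq k j).
  by rewrite /sproj big_nat_recr.
rewrite IH /unit_seq ltnS; case: ltngtP => [_|_|->].
- by rewrite mulr0 addr0.
- by rewrite mulr0 addr0.
- by rewrite mulr1 add0r.
Qed.

Lemma seqspace_eq u v : coords u =1 coords v -> u = v.
Proof. by move=> h; apply: val_inj; exact/funext. Qed.

Lemma proj_lin k : linear (fun v => sproj k v).
Proof.
by move=> c u v; apply: seqspace_eq => i; rewrite coords_proj truncateD truncateZ
  -!coords_proj.
Qed.

Lemma rnorm_proj k v : rnorm (sproj k v) <= rnorm v.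
Proof.
apply: rnorm_le_fnorm => m; rewrite coords_proj.
exact: le_trans (fnorm_trunc sc x m k v) (fnorm_le_rnorm m v).
Qed.

Lemma proj_cvg v (e : R) : 0 < e ->
  exists k0, forall k, (k0 <= k)%N -> rnorm (v - sproj k v) <= e.
Proof.
move=> e0; have [k0 hk] := trunc_cvg x1 (fun m => euc_le_rnorm m v) e0.
exists k0 => k /hk h; apply: rnorm_le_fnorm => m.
by rewrite seqspaceB coords_proj.
Qed.

Lemma partD l u v : part l (coords (u + v)) = part l u + part l v.
Proof. exact: (linD (part_lin x l)). Qed.

Lemma partZ l c v : part l (coords (c *: v)) = c *: part l v.
Proof. exact: (linZ (part_lin x l)). Qed.

(** * Functionals on tails of the unit ball *)

Section Shrinking.
Variable f : G -> K.
Hypothesis df : dual G f.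
Hypothesis weakly_null : forall g, dual F g -> forall e : R, 0 < e ->
  exists k0, forall k, (k0 <= k)%N -> rnorm (g (x k)) <= e.

Let lf := proj1 df.

(* If [f] did not tend to zero on the tails of the unit ball, the convex sets
   [slab d 1 m] would be nonempty for all [m]; convex combinations of far out
   elements then produce elements of arbitrarily small norm. *)
Definition slab (d c : R) m u :=
  [/\ exists k, forall i, (k <= i)%N -> coords u i = 0,
      forall i, (i < m)%N -> coords u i = 0,
      rnorm u <= c & c * d <= rl (f u)].

Lemma slabD d c c' m u v : slab d c m u -> slab d c' m v ->
  slab d (c + c') m (u + v).
Proof.
move=> [[k ku] mu uc fu] [[l lv] mv vc fv]; split.
- exists (maxn k l) => i; rewrite geq_max seqspaceD => /andP[/ku -> /lv ->].
  by rewrite addr0.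
- by move=> i im; rewrite seqspaceD mu // mv // addr0.
- by apply: le_trans (rnormD _ _ _) _; exact: lerD.
- by rewrite (linD lf) rlD mulrDl lerD.
Qed.

Lemma slabZ d c m u (t : R) : 0 <= t -> slab d c m u ->
  slab d (t * c) m (ofR t *: u).
Proof.
move=> t0 [[k ku] mu uc fu]; split.
- by exists k => i /ku; rewrite seqspaceZ => ->; rewrite mulr0.
- by move=> i /mu; rewrite seqspaceZ => ->; rewrite mulr0.
- by rewrite rnormZ rnorm_ofR ger0_norm // ler_wpM2l.
- by rewrite (linZ lf) rlM -mulrA ler_wpM2l.
Qed.

Lemma slab_mono d c l m u : (l <= m)%N -> slab d c m u -> slab d c l u.
Proof. by move=> lm [? h ? ?]; split=> // i il; apply: h; exact: leq_trans il lm. Qed.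

Lemma part_const k l a : (forall i, (k <= i)%N -> a i = 0) -> (k <= l)%N ->
  part l a = part k a.
Proof.
move=> ka kl; rewrite /part (@big_cat_nat _ _ _ k 0 l) //=.
rewrite [X in _ + X]big_nat_cond [X in _ + X]big1 ?addr0 //.
by move=> i /andP[/andP[ki _] _]; rewrite ka // scale0r.
Qed.

Lemma part_low l m a : (forall i, (i < m)%N -> a i = 0) -> (l <= m)%N ->
  part l a = 0.
Proof.
move=> am lm; rewrite /part big_nat_cond big1 // => i /andP[/andP[_ il] _].
by rewrite am ?scale0r // (leq_trans il lm).
Qed.

Variable d : R.
Hypothesis d0 : 0 < d.
Hypothesis slab_ex : forall m, exists u, slab d 1 m u.

(** Here [part k u] is the full image of [u] in [F]. If all these images had norm above [e], some
    [phi] would have real part at least [e] on them. But for [u] supported far out, [phi] is small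
    on the l1 piece of [u], as [x] is weakly null, and the other piece is uniformly small. *)
Lemma slab_small_image m (e : R) : 0 < e -> exists u k,
  [/\ slab d 1 m u, forall i, (k <= i)%N -> coords u i = 0 & rnorm (part k u) <= e].
Proof.
move=> e0; apply: contrapT => hn.
pose C := [set y | exists u k, [/\ slab d 1 m u,
  forall i, (k <= i)%N -> coords u i = 0 & y = part k u]].
have [||||phi [dphi phin phiC]] := @separation R K sc F C e.
- have [u su] := slab_ex m; have [[k ku] _ _ _] := su.
  by exists (part k u), u, k.
- move=> _ _ t [u [k [su ku ->]]] [v [l [sv lv ->]]] /andP[t0 t1].
  exists (ofR t *: u + ofR (1 - t) *: v), (maxn k l).
  have t1' : 0 <= 1 - t by lra.
  split.
  + have := slabD (slabZ t0 su) (slabZ t1' sv).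
    by rewrite !mulr1 addrC subrK.
  + move=> i; rewrite geq_max seqspaceD !seqspaceZ => /andP[/ku -> /lv ->].
    by rewrite !mulr0 addr0.
  + rewrite partD !partZ.
    by rewrite (part_const ku) ?leq_maxl // (part_const lv) ?leq_maxr.
- exact: ltW.
- move=> _ [u [k [su ku ->]]]; rewrite leNgt; apply/negP => h.
  by apply: hn; exists u, k; split=> //; exact: ltW.
(* The constant 3 exceeds [euc l u <= 2]. The [maxpart] piece then contributes at most
   [2 * (e / 8)], and the l1 piece at most [2 ^+ n * 3] times the bound on [phi (x i)], again
   [e / 4]. *)
have [n hn'] : exists n, (2^-1) ^+ n < e / 8 / 3 by apply: half_small; lra.
have t0 := @pow_two_gt0 R n.
have c0 : 0 < e / 4 / (2 ^+ n * 3) by rewrite !divr_gt0 // mulr_gt0.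
have [k0 hk0] := weakly_null dphi c0.
have [u su] := slab_ex (maxn m k0).
have [[k ku] lu u1 _] := su.
pose l := maxn (maxn k0 k) n.+1.
have k0l : (k0 <= l)%N by rewrite !leq_max leqnn.
have kl : (k <= l)%N by rewrite !leq_max leqnn orbT.
have nl : (n < l)%N by rewrite /l leq_max ltnSn orbT.
have /phiC : C (part l u).
  exists u, l; split=> //; first exact: slab_mono (leq_maxl _ _) su.
  by move=> i li; apply: ku; exact: leq_trans kl li.
have [|b [b1 b2]] := @mix_split R K sc F x n l u 3.
  apply: le_lt_trans (mix_le_euc sc x _ nl) _.
  by have := euc_le_rnorm l u; lra.
have pk0 : part k0 u = 0 by apply: part_low lu _; exact: leq_maxr.
have e1 i : part i u = part i (coords u - b) + part i b.
  by rewrite -(linD (part_lin x _)) subrK.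
have -> : part l u = (part l (coords u - b) - part k0 (coords u - b)) +
    (part l b - part k0 b).
  by rewrite -[LHS]subr0 -pk0 (e1 l) (e1 k0) opprD addrACA.
have lphi := proj1 dphi.
have h1 : rnorm (phi (part l (coords u - b) - part k0 (coords u - b))) <= e / 4.
  apply: le_trans (phin _) _; apply: le_trans (rnormB _ _ _) _.
  have := part_le_maxpart sc x (coords u - b) (leqnn l).
  by have := part_le_maxpart sc x (coords u - b) k0l; lra.
have h2 : rnorm (phi (part l b - part k0 b)) <= e / 4.
  have -> : part l b - part k0 b = \sum_(k0 <= i < l) b i *: x i.
    by rewrite /part (@big_cat_nat _ _ _ k0 0 l) //= addrAC subrr add0r.
  rewrite (lin_sum lphi); apply: le_trans (rnorm_sum _ _ _ _) _.
  apply: le_trans (_ : \sum_(k0 <= i < l) rnorm (b i) * (e / 4 / (2 ^+ n * 3)) <= _).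
    rewrite !big_seq; apply: ler_sum => i; rewrite mem_index_iota => /andP[ki _].
    by rewrite (linZ lphi) rnormM ler_wpM2l ?rnorm_ge0 // hk0.
  rewrite -mulr_suml mulrA ler_pdivrMr ?mulr_gt0 // mulrC ler_wpM2l //; first by lra.
  apply: ltW; apply: le_lt_trans b1.
  rewrite /ell1 (@big_cat_nat _ _ _ k0 0 l) //= lerDr.
  by apply: sumr_ge0 => i _; exact: rnorm_ge0.
rewrite (linD lphi) rlD => h.
by have := rl_le_rnorm sc (phi (part l (coords u - b) - part k0 (coords u - b)));
   have := rl_le_rnorm sc (phi (part l b - part k0 b)); lra.
Qed.

(* The average of [r] successive elements with small images: a partial sum
   cuts at most one of them. *)
Lemma slab_small_parts m (e : R) : 0 < e ->
  exists u, slab d 1 m u /\ forall l, rnorm (part l u) <= e.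
Proof.
move=> e0; have e2 : 0 < e / 2 by lra.
have sums (r : nat) : exists w k, [/\ slab d r%:R m w,
    forall i, (k <= i)%N -> coords w i = 0, rnorm (part k w) <= r%:R * (e / 2) &
    forall l, rnorm (part l w) <= r%:R * (e / 2) + 1].
  elim: r => [|r [w [k [sw kw h1 h2]]]].
    have p0 i : part i (coords (0 : G)) = 0 := lin0 (part_lin x i).
    exists 0, 0%N; split=> //; rewrite ?p0 ?rnorm0 ?mul0r //; last first.
      by move=> l; rewrite p0 rnorm0 add0r ler01.
    split=> //; first by exists 0%N.
      by rewrite rnorm0.
    by rewrite (lin0 lf) rl0 mul0r.
  have [u [k' [su ku h3]]] := slab_small_image (maxn m k) e2.
  have [_ lu u1 _] := su.
  have rS : r.+1%:R * (e / 2) = r%:R * (e / 2) + e / 2.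
    by rewrite -natr1 mulrDl mul1r.
  exists (w + u), (maxn k k'); split.
  - rewrite -natr1; apply: slabD => //; exact: slab_mono (leq_maxl _ _) su.
  - by move=> i; rewrite geq_max seqspaceD => /andP[/kw -> /ku ->]; rewrite addr0.
  - rewrite partD (part_const kw) ?leq_maxl // (part_const ku) ?leq_maxr //.
    by apply: le_trans (rnormD _ _ _) _; rewrite rS; lra.
  - move=> l; rewrite partD; have [lk|kl] := leqP l k.
      rewrite (part_low lu) ?addr0; last by rewrite leq_max lk orbT.
      by have := h2 l; rewrite rS; lra.
    rewrite (part_const kw) ?(ltnW kl) //; apply: le_trans (rnormD _ _ _) _.
    by have := part_le_rnorm l u; rewrite rS; lra.
have [r hr] := archi_lt 1 e2.
have [w [k [sw _ _ h]]] := sums r.+1.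
have r0 : 0 < r.+1%:R :> R by [].
exists (ofR r.+1%:R^-1 *: w); split.
  by have := slabZ (ltW (_ : 0 < r.+1%:R^-1)) sw; rewrite mulVf ?pnatr_eq0 ?invr_gt0 //; exact.
move=> l; rewrite partZ.
rewrite rnormZ rnorm_ofR ger0_norm ?invr_ge0 // mulrC ler_pdivrMr // mulrC.
have : r%:R * (e / 2) <= r.+1%:R * (e / 2).
  by apply: ler_wpM2r; [exact: ltW|rewrite ler_nat].
by have := h l; rewrite -natr1 mulrDl; lra.
Qed.

(* Gliding hump over the scales [n] of [mix]: [r] elements with essentially
   disjoint humps have a sum of norm of order [sqrt r]. *)
Lemma slab_small_norm (e : R) : 0 < e ->
  exists u, slab d 1 0 u /\ forall m, euc m u <= e.
Proof.
move=> e0.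
have sums (r : nat) : exists w, slab d r%:R 0 w /\
    forall m, euc m w <= Num.sqrt (5 * r%:R).
  elim: r => [|r [w [sw hw]]].
    exists 0; split; last first.
      move=> m; rewrite mulr0 sqrtr0 [coords _]/(0 : nat -> K).
      by rewrite (seminorm_eq0 (seminorm_euc sc x m)).
    split=> //; first by exists 0%N.
      by rewrite rnorm0.
    by rewrite (lin0 lf) rl0 mul0r.
  set s := Num.sqrt (5 * r%:R) in hw.
  have s0 : 0 <= s by exact: sqrtr_ge0.
  have ss : s ^+ 2 = 5 * r%:R by rewrite sqr_sqrtr // mulr_ge0.
  (* Below scale [M] the old sum [w] has size at most [s] and the new [u], with tiny partial sums,
     at most [i]; from [M] on, [w] has at most [i] and [u] at most 2. This [i] makes [(s + i) ^+ 2 +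
     (i + 2) ^+ 2 <= s ^+ 2 + 5], so each summand adds 5 to the squared bound. *)
  pose i := (2 * s + 6)^-1.
  have i0 : 0 < i by rewrite invr_gt0; lra.
  have is1 : i * (2 * s + 6) = 1 by rewrite mulVf // gt_eqF //; lra.
  have [M hM] := mix_tail hw (exprn_gt0 2 i0).
  have D0 : 0 < 2 ^+ M * M.+1%:R :> R by rewrite mulr_gt0 // exprn_gt0.
  have [u [su hu]] := slab_small_parts 0 (divr_gt0 i0 D0).
  have [_ _ u1 _] := su.
  exists (w + u); split; first by rewrite -natr1; exact: slabD.
  move=> m; apply: le_trans (euc_mono sc x _ (leq_maxl m M)) _.
  set l := maxn m M; have Ml : (M <= l)%N by exact: leq_maxr.
  rewrite -ler_sqr ?nnegrE ?euc_ge0 ?sqrtr_ge0 // [leRHS]sqr_sqrtr ?mulr_ge0 //.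
  rewrite euc_sqr (@big_cat_nat _ _ _ M 0 l) //=.
  have hD n : mix n l (coords (w + u)) ^+ 2 <= (mix n l w + mix n l u) ^+ 2.
    rewrite ler_sqr ?nnegrE ?addr_ge0 ?mix_ge0 //.
    exact: (seminorm_mix sc x n l).1.
  apply: le_trans (_ : (s + i) ^+ 2 + (i + 2) ^+ 2 <= _); last first.
    have i1 : i <= 1 by nra.
    by rewrite -natr1; nra.
  apply: lerD.
    apply: le_trans (ler_sum _ (fun n _ => hD n)) _; apply: l2_add => //.
    - exact: ltW.
    - apply: le_trans (_ : euc l w ^+ 2 <= _).
        rewrite euc_sqr [leRHS](@big_cat_nat _ _ _ M 0 l) //= lerDl.
        by apply: sumr_ge0 => n _; exact: sqr_ge0.
      by rewrite ler_sqr ?nnegrE ?euc_ge0.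
    - apply: (mix_head (d := i / (2 ^+ M * M.+1%:R))).
      + exact: ltW.
      + by apply: maxpart_le => [|k _]; [exact/ltW/divr_gt0|exact: hu].
      rewrite (_ : _ * _ * _ = i * (M%:R / M.+1%:R)).
        rewrite -[leRHS]mulr1 ler_wpM2l ?(ltW i0) //.
        by rewrite ler_pdivrMr // mul1r ler_nat.
      by field; rewrite nat1r pnatr_eq0 /= expf_neq0.
  apply: le_trans (ler_sum _ (fun n _ => hD n)) _; apply: l2_add => //.
  - exact: ltW.
  - apply: le_trans (_ : euc l u ^+ 2 <= _).
      rewrite euc_sqr [leRHS](@big_cat_nat _ _ _ M 0 l) //= lerDr.
      by apply: sumr_ge0 => n _; exact: sqr_ge0.
    rewrite ler_sqr ?nnegrE ?euc_ge0 //.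
    by have := euc_le_rnorm l u; lra.
have [r hr] := archi_lt 5 (exprn_gt0 2 e0).
have [w [sw hw]] := sums r.+1.
have r0 : 0 < r.+1%:R :> R by [].
exists (ofR r.+1%:R^-1 *: w); split.
  by have := slabZ (ltW (_ : 0 < r.+1%:R^-1)) sw; rewrite mulVf ?pnatr_eq0 ?invr_gt0 //; exact.
move=> m; rewrite (seminormZ _ (coords w) (seminorm_euc sc x m)).
rewrite rnorm_ofR ger0_norm ?invr_ge0 // mulrC ler_pdivrMr // mulrC.
apply: le_trans (hw m) _; rewrite -[leRHS]ger0_norm ?mulr_ge0 ?(ltW e0) //.
rewrite -sqrtr_sqr ler_wsqrtr // exprMn.
have : r%:R * e ^+ 2 <= r.+1%:R * e ^+ 2 by rewrite ler_wpM2r ?ler_nat ?sqr_ge0.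
have : 0 <= e ^+ 2 by exact: sqr_ge0.
by nra.
Qed.

Lemma slab_absurd : False.
Proof.
have [_ [C [C0 hC]]] := (bounded_opP sc f).1 df.
have e0 : 0 < d / (5 * (C + 1)) by rewrite divr_gt0 //; lra.
have [u [[_ _ _ fu] hu]] := slab_small_norm e0.
have u5 : rnorm u <= 5 * (d / (5 * (C + 1))).
  apply: rnorm_le_fnorm => m; apply: le_trans (fnorm_le_euc x1 _ _) _.
  by rewrite ler_wpM2l.
have C1 : 0 < C + 1 by lra.
have qd : 5 * (d / (5 * (C + 1))) * (C + 1) = d by field; rewrite gt_eqF.
have := le_trans (rl_le_rnorm sc (f u)) (le_trans (hC u) (ler_wpM2l C0 u5)).
by rewrite mul1r in fu; move: qd; rewrite mulrDr mulr1 [_ * C]mulrC; lra.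
Qed.

End Shrinking.
End FactorizationSpace.

(** * Reflexivity, basis and the operator that misses its norm *)

Section FactorizationTheorem.
Context {R : realType} {K : numFieldType} (sc : real_part R K).
Local Notation ofR := (ofR sc).
Local Notation rl := (rl sc).
Local Notation rnorm := (rnorm sc).
Context {F : completeNormedModType K} (x : nat -> F).
Hypothesis x1 : forall k, rnorm (x k) = 1.
Hypothesis weakly_null : forall g, dual F g -> forall e : R, 0 < e ->
  exists k0, forall k, (k0 <= k)%N -> rnorm (g (x k)) <= e.
Implicit Types (a b : nat -> K) (n m k l : nat).
Local Notation G := (seqspace (factor_seqnorm x1)).
Local Notation sproj := (sproj x1).
Implicit Types u v w : G.

(** A failure would populate every slab of height [e / 4]: a bad remainder is rotated, halved to
    return to the unit ball, and cut to finite support. Its value exceeds [e / 2] before the cut,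
    which loses at most [e / 4]. *)
Lemma shrinking (f : G -> K) (e : R) : dual G f -> 0 < e ->
  exists m0, forall m, (m0 <= m)%N -> forall v, rnorm v <= 1 ->
    rnorm (f (v - sproj m v)) <= e.
Proof.
move=> df e0; apply: contrapT => /forallNP hn.
have [lf [C [C0 hC]]] := (bounded_opP sc f).1 df.
have e4 : 0 < e / 4 by lra.
apply: (slab_absurd df weakly_null e4) => m0.
have [m [v [mm [v1 fv]]]] : exists m v, (m0 <= m)%N /\ rnorm v <= 1 /\
    e < rnorm (f (v - sproj m v)).
  apply: contrapT => h; apply: (hn m0) => m mm v v1; rewrite leNgt.
  by apply/negP => hlt; apply: h; exists m, v.
have [t [t1 tf]] := rotation sc (f (v - sproj m v)).
pose u := (ofR 2^-1 * t) *: (v - sproj m v).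
have u1 : rnorm u <= 1.
  rewrite rnormZ rnormM t1 rnorm_ofR mulr1 ger0_norm ?invr_ge0 //.
  by have := rnormB sc v (sproj m v); have := rnorm_proj m v; lra.
have fu : e / 2 < rl (f u).
  by rewrite (linZ lf) -[_ *: _]mulrA rlM tf; move: fv; rewrite /rnorm; lra.
have C1 : 0 < C + 1 by lra.
have [k hk] := proj_cvg u (divr_gt0 e4 C1).
exists (sproj k u); split.
- by exists k => i ki; rewrite coords_proj /truncate ltnNge ki.
- move=> i im; rewrite coords_proj /truncate; case: ifP => // _.
  rewrite seqspaceZ seqspaceB coords_proj.
  rewrite [X in _ * X](_ : _ = coords v i - truncate m v i) //.
  by rewrite /truncate (leq_trans im mm) subrr mulr0.
- exact: le_trans (rnorm_proj _ _) u1.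
have := hC (u - sproj k u); have := hk k (leqnn k); rewrite ler_pdivlMr // => h1 h2.
have := rl_le_rnorm sc (f (u - sproj k u)); rewrite {1}(linB lf) rlB.
by have := rnorm_ge0 sc (u - sproj k u); nra.
Qed.

Lemma dual_comb (E : normedModType K) (c : K) (f g : E -> K) :
  dual E f -> dual E g -> dual E (c *: f + g).
Proof.
move=> /(bounded_opP sc)[lf [C [C0 hC]]] /(bounded_opP sc)[lg [D [D0 hD]]].
apply/(bounded_opP sc); split.
  move=> t y z; transitivity (c * f (t *: y + z) + g (t *: y + z)) => //.
  rewrite (linD lf) (linZ lf) (linD lg) (linZ lg).
  transitivity (t * (c * f y + g y) + (c * f z + g z)) => //.
  by rewrite /GRing.scale /=; ring.
exists (rnorm c * C + D); split=> [|u].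
  by rewrite addr_ge0 // mulr_ge0 // rnorm_ge0.
apply: le_trans (rnormD sc (c * f u) (g u)) _; rewrite rnormM mulrDl lerD //.
by rewrite -mulrA ler_wpM2l ?rnorm_ge0.
Qed.

Lemma dual_coord i : dual G (fun v => coords v i).
Proof.
apply/(bounded_opP sc); split; first by [].
by exists 4; split=> // v; exact: coord_le_rnorm.
Qed.

Lemma dual_proj m (f : G -> K) : dual G f -> dual G (fun v => f (sproj m v)).
Proof.
move=> df; apply: (comp_dual sc (T := fun v => sproj m v) _ df).
apply/(bounded_opP sc); split; first exact: proj_lin.
by exists 1; split=> // v; rewrite mul1r rnorm_proj.
Qed.

Lemma dual0 (E : normedModType K) : dual E 0.
Proof.
apply/(bounded_opP sc); split; first by move=> c u v; rewrite scaler0 addr0.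
by exists 0; split=> // u; rewrite rnorm0 mul0r.
Qed.

Lemma bidual_le (E : normedModType K) (Phi : (E -> K) -> K) : bidual E Phi ->
  exists M : R, 0 <= M /\ forall h (D : R), dual E h -> 0 <= D ->
    (forall v : E, rnorm v <= 1 -> rnorm (h v) <= D) -> rnorm (Phi h) <= M * D.
Proof.
move=> [_ [M hM]]; exists (rnorm M); split; first exact: rnorm_ge0.
move=> h D dh D0 hD; have [c [ec c0 _ cmin]] := opnormP sc dh.
apply: le_trans (_ : rnorm M * c <= _); last first.
  by rewrite ler_wpM2l ?rnorm_ge0 // cmin.
have := hM h dh; rewrite ec => Mc.
have Mc0 := le_trans (normr_ge0 _) Mc.
apply: le_trans (rl_mono sc Mc) _; apply: le_trans (rl_le_rnorm _ _) _.
by rewrite rnormM rnorm_ofR ger0_norm.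
Qed.

(* James: the values of [Phi] at the coordinate functionals are the coordinates
   of the vector representing [Phi]. *)
Lemma factor_reflexive : reflexive_space G.
Proof.
move=> Phi bPhi; have [PhiL _] := bPhi; have [M [M0 hM]] := bidual_le bPhi.
pose a k := Phi (fun v => coords v k).
have Phi0 : Phi 0 = 0.
  have := PhiL 1 0 0 (dual0 G) (dual0 G).
  by rewrite scale1r addr0 mul1r => /eqP; rewrite -subr_eq0 opprD addrA subrr sub0r oppr_eq0 => /eqP.
have Phi_proj m f : dual G f -> Phi (fun v => f (sproj m v)) = f (sproj m a).
  move=> df; have [lf _] := df; elim: m => [|m IH].
    rewrite (_ : (fun v => _) = 0); last first.
      by apply/funext => v; rewrite /sproj big_geq // (lin0 lf).
    by rewrite Phi0 /sproj big_geq // (lin0 lf).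
  have e b : f (sproj m.+1 b) = f (basis_vec x1 m) * b m + f (sproj m b).
    by rewrite /sproj big_nat_recr //= (linD lf) (linZ lf) addrC mulrC.
  rewrite e -IH -(PhiL _ _ _ (dual_coord m) (dual_proj m df)).
  by congr Phi; apply/funext => v; rewrite e.
have proj_le m : rnorm (sproj m a) <= M.
  have [f [df fn <-]] := norming_functional sc (sproj m a).
  rewrite -Phi_proj //; apply: le_trans (rl_le_rnorm _ _) _.
  rewrite -[leRHS]mulr1; apply: hM => //; first exact: dual_proj.
  by move=> v v1; apply: le_trans (fn _) _; exact: le_trans (rnorm_proj _ _) v1.
(* Each [fnorm m] sees finitely many coordinates, so it does not distinguish [a] from a long
   truncation, whose norm is at most [M]. *)
have adom : a \in seqdom (factor_seqnorm x1).
  apply/seqdomP; exists M => m; rewrite [sn _ _ _]/(fnorm sc x m a).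
  have [C [k [C0 hC]]] := fnorm_le_coord x1 m.
  rewrite -(subrK (truncate k a) a).
  apply: le_trans ((seminorm_fnorm sc x m).1 _ _) _.
  have -> : fnorm sc x m (a - truncate k a) = 0.
    apply/eqP; rewrite eq_le (seminorm_ge0 _ (seminorm_fnorm sc x m)) andbT.
    apply: le_trans (hC _) _; rewrite big1 ?mulr0 // => i _.
    rewrite [X in rnorm X](_ : _ = a i - truncate k a i) //.
    by rewrite /truncate ltn_ord subrr rnorm0.
  rewrite add0r -(coords_proj x1); exact: le_trans (fnorm_le_rnorm m _) (proj_le k).
pose va : G := SeqSpace adom.
exists va => f df; rewrite /canonical_embedding.
have [lf [C [C0 hC]]] := (bounded_opP sc f).1 df.
apply/eqP; rewrite -subr_eq0; apply/eqP; apply: (rnorm_eq0 (sc := sc)).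
apply/eqP; rewrite eq_le rnorm_ge0 andbT; apply/ler_addgt0Pl => e e0; rewrite addr0.
have D0 : 0 < 2 * (M + C + 1) by lra.
have d0 := divr_gt0 e0 D0; set d := e / _ in d0.
have ed : 2 * (M + C + 1) * d = e by rewrite /d mulrC divfK // gt_eqF.
have [m1 hm1] := shrinking df d0.
have [m2 hm2] := proj_cvg va d0.
pose m := maxn m1 m2.
(* By [shrinking], [f] composed with [sproj m] is within [d] of [f] in the dual norm, and [Phi] is
   bounded by [M]. *)
have h1 : rnorm (Phi f - f (sproj m a)) <= M * d.
  rewrite -Phi_proj //.
  have -> : Phi f - Phi (fun v => f (sproj m v)) =
      Phi ((-1) *: (fun v => f (sproj m v)) + f).
    by rewrite PhiL ?mulN1r 1?addrC //; exact: dual_proj.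
  apply: hM => //; [apply: dual_comb => //; exact: dual_proj|exact: ltW|].
  move=> v v1; have := hm1 m (leq_maxl _ _) v v1.
  rewrite (linB lf); congr (rnorm _ <= _).
  by rewrite addrC -[- _]mulN1r.
have h2 : rnorm (f (sproj m a) - f va) <= C * d.
  rewrite -(linB lf).
  apply: le_trans (hC _) _; rewrite ler_wpM2l //.
  by rewrite rnormBC; apply: hm2; exact: leq_maxr.
have := rnorm_triangle sc (Phi f) (f (sproj m a)) (f va); nra.
Qed.

Lemma factor_basis : has_schauder_basis G.
Proof.
exists (basis_vec x1) => v; exists (coords v); split.
  apply/(cvg_rnorm sc) => e e0.
  have e2 : 0 < e / 2 by lra.
  have [k0 hk0] := proj_cvg v e2.
  exists k0 => // k /= kk; apply: le_lt_trans (hk0 k kk) _; lra.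
move=> b /(cvg_rnorm sc) hb; apply/funext => i; apply/eqP.
rewrite -subr_eq0; apply/eqP; apply: (rnorm_eq0 (sc := sc)); apply/eqP.
rewrite eq_le rnorm_ge0 andbT; apply/ler_addgt0Pl => e e0; rewrite addr0.
have e4 : 0 < e / 4 by lra.
have [N _ hN] := hb _ e4.
have h := hN (maxn N i.+1) (leq_maxl _ _).
have := coord_le_rnorm i (v - sproj (maxn N i.+1) b).
rewrite seqspaceB coords_proj [X in rnorm X](_ : _ = v i - b i); last first.
  transitivity (v i - truncate (maxn N i.+1) b i) => //.
  by rewrite /truncate leq_max ltnSn orbT.
by move: h; rewrite /series /= -/(sproj _ _); lra.
Qed.

(** The images [x k] have norm one and the unit vectors norm at most [1 + 2 ^ - k], so the operator
    norm is at least 1. A nonzero coordinate [i] of [v] costs: the image has norm at most that of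
    [v] minus [2 ^ - i] times the modulus of the coordinate. *)
Lemma factor_not_norm_attaining : exists T : G -> F,
  bounded_op G F T /\ ~ norm_attaining G F T.
Proof.
have /choice[T hT] v : exists y, forall e : R, 0 < e ->
    \forall l \near \oo, rnorm (part x l v - y) < e.
  have /cauchy_cvgP/cvg_ex[y hy] : cauchy ((fun l => part x l v) @ \oo).
    apply: cauchy_exP => e e0.
    have e2 : 0 < rl e / 2 by rewrite divr_gt0 // rl_gt0.
    have [k0 hk0] := part_cauchy x1 (fun m => euc_le_rnorm m v) e2.
    exists (part x k0 v); exists k0 => // l /= kl.
    rewrite -ball_normE /= -(ofR_rnorm sc) -(ofR_rl sc (ltW e0)) ofR_lt rnormBC.
    by have := hk0 k0 l (leqnn _) kl; lra.
  exists y => e e0; apply: filterS ((cvg_rnorm sc _ _ _).1 hy e e0) => l /=.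
  by rewrite rnormBC.
have bT : bounded_op G F T.
  apply/(bounded_opP sc); split.
    move=> c u v; apply: (near_lim_uniq _ (hT _)) => e e0.
    have c1 : 0 < rnorm c + 1 by have := rnorm_ge0 sc c; lra.
    have e2 : 0 < e / 2 by lra.
    have := hT v _ e2; have := hT u _ (divr_gt0 e2 c1).
    apply: filterS2 => l; rewrite ltr_pdivlMr // => h1 h2.
    rewrite partD partZ opprD addrACA -scalerBr.
    apply: le_lt_trans (rnormD _ _ _) _; rewrite rnormZ.
    by have := rnorm_ge0 sc c; have := rnorm_ge0 sc (part x l u - T u); nra.
  exists 1; split=> // v; rewrite mul1r.
  apply: (near_rnorm_le _ (hT v)); apply: nearW => l; exact: part_le_rnorm.
exists T; split=> // -[_ [v v1 Tv]].
have [c [ec c0 hc _]] := opnormP sc bT.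
have {}v1 : rnorm v <= 1 by rewrite -(ofR_le sc) ofR_rnorm rmorph1.
have {Tv} Tv : rnorm (T v) = c by rewrite /rnorm Tv ec rl_ofR.
have c1 : 1 <= c.
  apply/ler_addgt0Pl => e e0.
  have e1 : 0 < e / (c + 1) by apply: divr_gt0 => //; lra.
  have [k hk] := half_small e1.
  have Tk : T (basis_vec x1 k) = x k.
    apply: (near_lim_uniq _ (hT _)) => d d0; exists k.+1 => // l /= kl.
    rewrite [part _ _ _](_ : _ = x k) ?subrr ?rnorm0 //.
    rewrite (@part_const _ _ x k.+1) //; last first.
      by move=> i ki /=; rewrite /unit_seq gtn_eqF.
    rewrite /part big_nat_recr //= /unit_seq eqxx scale1r big_nat_cond big1 ?add0r //.
    by move=> i /andP[/andP[_ ik] _]; rewrite ltn_eqF // scale0r.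
  have nk : rnorm (basis_vec x1 k) <= 1 + (2^-1) ^+ k.
    apply: rnorm_le_fnorm => m; rewrite /fnorm ge_max; apply/andP; split.
      by have := euc_unit_seq sc x k m; have := @pow_half_gt0 R k; lra.
    rewrite big_seq; apply: (big_ind (fun z => z <= _)) => [|p q hp hq|l _].
    - by rewrite addr_ge0 // exprn_ge0.
    - by rewrite ge_max hp hq.
    apply: lerD.
      apply: le_trans (part_le_ell1 x1 _ _) _; exact: ell1_unit_seq.
    have [kl|lk] := ltnP k l.
      rewrite /damp (@big_cat_nat _ _ _ k 0 l) ?(ltnW kl) //= [X in _ + X]big_ltn //.
      rewrite /unit_seq eqxx rnorm1 mulr1 big_nat_cond big1 => [|i].
        rewrite add0r big_nat_cond big1 ?addr0 // => i /andP[/andP[ki _] _].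
        by rewrite gtn_eqF // rnorm0 mulr0.
      by move=> /andP[/andP[_ ik] _]; rewrite ltn_eqF // rnorm0 mulr0.
    rewrite /damp big_nat_cond big1 ?exprn_ge0 // => i /andP[/andP[_ il] _].
    by rewrite /= /unit_seq ltn_eqF ?rnorm0 ?mulr0 // (leq_trans il).
  have := hc (basis_vec x1 k); rewrite Tk x1 => h.
  have := ler_wpM2l c0 nk; move: hk; rewrite ltr_pdivlMr; last by lra.
  by have := @pow_half_gt0 R k; nra.
have [v0|/existsNP[i vi]] := pselect (forall i, coords v i = 0).
  have v00 : v = 0 by apply: seqspace_eq => i; rewrite v0.
  by move: Tv c1; rewrite v00 (lin0 (proj1 bT)) rnorm0; lra.
pose d := (2^-1) ^+ i * rnorm (coords v i).
have d0 : 0 < d.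
  rewrite mulr_gt0 ?exprn_gt0 // lt_def rnorm_ge0 andbT; apply/eqP => h.
  exact/vi/(rnorm_eq0 h).
suff : rnorm (T v) <= 1 - d by lra.
apply: (near_rnorm_le _ (hT v)); exists i.+1 => // l /= il.
have := le_trans (damped_le_fnorm sc x v (leqnn l)) (fnorm_le_rnorm l v).
suff : d <= damp sc l v by lra.
rewrite /damp (@big_cat_nat _ _ _ i 0 l) ?(ltnW il) //= [X in _ + X]big_ltn //.
rewrite addrCA lerDl addr_ge0 //; apply: sumr_ge0 => j _;
  by rewrite mulr_ge0 ?rnorm_ge0 ?exprn_ge0.
Qed.

End FactorizationTheorem.

(** * The cycle of implications *)

Section Equivalence.
Context {R : realType} {K : numFieldType} (sc : real_part R K).
Local Notation ofR := (ofR sc).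
Local Notation rl := (rl sc).
Local Notation rnorm := (rnorm sc).

(** Differences [z - u n] of norm at least [e] stay weakly null after normalization, the factors
    being at most [e^-1]. *)
Lemma not_schur_sequence (F : normedModType K) : ~ schur_property F ->
  exists x : nat -> F, (forall k, rnorm (x k) = 1) /\
    forall g, dual F g -> forall e : R, 0 < e ->
      exists k0, forall k, (k0 <= k)%N -> rnorm (g (x k)) <= e.
Proof.
move=> /existsNP[u /not_implyP[[z uz] nu]].
have [e [e0 he]] : exists e : R, 0 < e /\
    ~ (\forall n \near \oo, rnorm (z - u n) < e).
  apply: contrapT => /forallNP h; apply: nu; apply/cvg_ex; exists z.
  by apply/(cvg_rnorm sc) => e e0; apply: contrapT => ?; apply: (h e).
have /choice[n hn] (N : nat) : exists n, (N <= n)%N /\ e <= rnorm (z - u n).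
  apply: contrapT => /forallNP h; apply: he; exists N => // n /= Nn.
  by rewrite ltNge; apply/negP => ?; apply: (h n).
pose r k := rnorm (z - u (n k)).
have r0 k : 0 < r k by exact: lt_le_trans e0 (hn k).2.
exists (fun k => ofR (r k)^-1 *: (z - u (n k))); split=> [k|g dg d d0].
  by rewrite rnormZ rnorm_ofR ger0_norm ?invr_ge0 ?ltW // mulVf // gt_eqF.
have [N _ hN] := (cvg_rnorm sc _ _ _).1 (uz g dg) _ (mulr_gt0 d0 e0).
exists N => k Nk; have [lg _] := dg.
rewrite (linZ lg) rnormM rnorm_ofR ger0_norm ?invr_ge0 ?(ltW (r0 k)) //.
rewrite mulrC ler_pdivrMr // (linB lg).
apply: le_trans (ltW (hN (n k) (leq_trans Nk (hn k).1))) _.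
by rewrite ler_pM2l //; exact: (hn k).2.
Qed.

Theorem schur_equivalences (F : completeNormedModType K) :
  [<-> schur_property F;
       forall E : completeNormedModType K, reflexive_space E ->
         compact_op E F = bounded_op E F;
       forall E : completeNormedModType K, reflexive_space E ->
         norm_attaining E F = bounded_op E F;
       forall G : completeNormedModType K,
         reflexive_space G -> has_schauder_basis G ->
         compact_op G F = bounded_op G F;
       forall G : completeNormedModType K,
         reflexive_space G -> has_schauder_basis G ->
         norm_attaining G F = bounded_op G F].
Proof.
have ab : schur_property F -> forall E : completeNormedModType K,
    reflexive_space E -> compact_op E F = bounded_op E F.
  move=> sF E rE; apply/seteqP; split=> [T []//|T bT].
  exact (schur_compact sc sF rE bT).
have bc (E : completeNormedModType K) : reflexive_space E ->
    compact_op E F = bounded_op E F -> norm_attaining E F = bounded_op E F.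
  move=> rE cE; apply/seteqP; split=> [T []//|T]; rewrite -cE => cT.
  exact: (compact_norm_attaining sc).
have ea : (forall G : completeNormedModType K, reflexive_space G ->
    has_schauder_basis G -> norm_attaining G F = bounded_op G F) ->
    schur_property F.
  move=> hG; apply: contrapT => /not_schur_sequence[x [x1 wx]].
  have [T [bT]] := factor_not_norm_attaining x1.
  rewrite -(hG _ (@factor_reflexive _ _ _ _ _ x1 wx) (factor_basis x1)) in bT.
  by apply.
tfae.
- exact: ab.
- by move=> hb E rE; apply: bc => //; exact: hb.
(* Compactness is recovered from norm attainment only through the Schur property: (c) contains (e),
   which gives (a), which gives (b) and with it (d). *)
- by move=> hc G rG _; apply: ab => //; apply: ea => E rE _; exact: hc.
- by move=> hd G rG bG; apply: bc => //; exact: hd.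
- exact: ea.
Qed.

End Equivalence.

Theorem theoremC (R : realType) (K : numFieldType)
    (hK : K = (R : numFieldType) \/ K = (R[i]%type : numFieldType))
    (F : completeNormedModType K) :
  [<-> schur_property F;
       forall E : completeNormedModType K, reflexive_space E ->
         compact_op E F = bounded_op E F;
       forall E : completeNormedModType K, reflexive_space E ->
         norm_attaining E F = bounded_op E F;
       forall G : completeNormedModType K,
         reflexive_space G -> has_schauder_basis G ->
         compact_op G F = bounded_op G F;
       forall G : completeNormedModType K,
         reflexive_space G -> has_schauder_basis G ->
         norm_attaining G F = bounded_op G F].
Proof.
case: hK => eK; move: F; rewrite eK => F.
  by have [sc] := real_part_real R; exact: schur_equivalences sc F.
by have [sc] := real_part_complex R; exact: schur_equivalences sc F.
Qed.
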